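(* For any $d\in\mathbb{N}^*$ and $R_\mu,R_\nu,M>0$, there is $C>0$ such that for any probability measures $\mu,\nu$ on $\mathbb{R}^d$ supported on $B_{R_\mu}$ and $B_{R_\nu}$ respectively, with $\mu(A)\le M\lambda(A)$ for any measurable set $A\subset\mathbb{R}^d$, and with optimal coupling $\gamma$, and for any probability measures $\tilde\mu,\tilde\nu$ also supported on $B_{R_\mu}$ and $B_{R_\nu}$ respectively, with optimal coupling $\tilde\gamma$, we have $$\frac{1}{C^8}W_2(\gamma,\tilde\gamma)^8\le W_2(\mu,\tilde\mu)+W_2(\nu,\tilde\nu).$$
   Context: $B_r$ is the open Euclidean ball of $\mathbb{R}^d$ centered at $0$ with radius $r$; $\lambda$ is the Lebesgue measure. An optimal coupling for a pair $(\alpha,\beta)$ of compactly supported probability measures on $\mathbb{R}^d$ is a minimizer of $\int\frac12\|x-y\|^2d\gamma(x,y)$ over probability measures $\gamma$ on $\mathbb{R}^d\times\mathbb{R}^d$ with marginals $\alpha$ and $\beta$. $W_2$ is the 2-Wasserstein distance for the Euclidean norm (on $\mathbb{R}^d$ or on $\mathbb{R}^d\times\mathbb{R}^d\simeq\mathbb{R}^{2d}$). *)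

(* Defs.v *)
From HB Require Import structures.
From mathcomp Require Import all_boot all_order all_algebra.
From mathcomp Require Import all_classical all_reals all_analysis.

Set Implicit Arguments.
Unset Strict Implicit.
Unset Printing Implicit Defensive.
Import Order.TTheory GRing.Theory Num.Theory.
Local Open Scope classical_set_scope.
Local Open Scope ring_scope.

(* R^d is the type of d-tuples of reals: mathcomp-analysis equips tuples, but
   not row vectors, with a sigma-algebra.  It is the one generated by the
   coordinates, that is, the Borel sigma-algebra of R^d. *)
Notation Rd R d := (d.-tuple (measurableTypeR R)).

Section euclidean.
Context {R : realType}.

Definition euclid_dist d (x y : Rd R d) : R :=
  Num.sqrt (\sum_(i < d) (tnth x i - tnth y i) ^+ 2).

(* The Euclidean distance of R^{2d}, read on R^d * R^d. *)
Definition euclid_dist_prod d (p q : Rd R d * Rd R d) : R :=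
  Num.sqrt (euclid_dist p.1 q.1 ^+ 2 + euclid_dist p.2 q.2 ^+ 2).

Definition euclid_origin d : Rd R d := [tuple (0 : R) | i < d].

Definition euclid_ball d (r : R) : set (Rd R d) := [set x | euclid_dist x (euclid_origin d) < r].

End euclidean.

(* Lebesgue measure on R^n: the dirac mass on the one-point space R^0, and the
   image of the product of the Lebesgue measures of R and R^n under the
   bijection (x, v) |-> x :: v onto R^(n+1).  [lebesgue_Rd_box] below computes
   it on boxes, which determines it. *)
Section lebesgue_cons.
Local Open Scope ereal_scope.
Context {R : realType} (n : nat).

Definition cons_Rd (p : measurableTypeR R * Rd R n) : Rd R n.+1 :=
  [tuple of p.1 :: p.2].

Lemma measurable_cons_Rd : measurable_fun [set: _] cons_Rd.
Proof. exact: (measurable_cons measurable_fst measurable_snd). Qed.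

Variable m : {sigma_finite_measure set (Rd R n) -> \bar R}.

Definition lebesgue_cons : set (Rd R n.+1) -> \bar R :=
  pushforward (lebesgue_measure \x m) cons_Rd.

Let lebesgue_cons0 : lebesgue_cons set0 = 0.
Proof. by rewrite /lebesgue_cons /pushforward preimage_set0 measure0. Qed.

Let lebesgue_cons_ge0 A : 0 <= lebesgue_cons A.
Proof. exact: integral_ge0. Qed.

Let lebesgue_cons_sigma_additive : semi_sigma_additive lebesgue_cons.
Proof.
have mc A : measurable A -> measurable (cons_Rd @^-1` A).
  by move=> mA; rewrite -[X in measurable X]setTI; exact: measurable_cons_Rd.
move=> F mF tF mUF; rewrite /lebesgue_cons /pushforward preimage_bigcup.
apply: measure_semi_sigma_additive; first by move=> k; exact: mc.
  apply/trivIsetP => /= i j _ _ ij; rewrite -preimage_setI.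
  by move/trivIsetP : tF => /(_ _ _ _ _ ij) ->//; rewrite preimage_set0.
by rewrite -preimage_bigcup; exact: mc.
Qed.

HB.instance Definition _ := isMeasure.Build _ _ _ lebesgue_cons
  lebesgue_cons0 lebesgue_cons_ge0 lebesgue_cons_sigma_additive.

Let lebesgue_cons_sigma_finite : sigma_finite [set: Rd R n.+1] lebesgue_cons.
Proof.
have /sigma_finiteP[F [TF ndF Foo]] := sigma_finiteT (@lebesgue_measure R).
have /sigma_finiteP[G [TG ndG Goo]] := sigma_finiteT m.
pose E k := [set x : Rd R n.+1 | F k (thead x) /\ G k [tuple of behead x]].
have bK x (v : Rd R n) : [tuple of behead (cons_Rd (x, v))] = v.
  exact: val_inj.
have EE k : cons_Rd @^-1` E k = F k `*` G k.
  apply/seteqP; split => -[x v]; rewrite /E /= theadE.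
    by move=> -[Fx Gv]; split => //; rewrite bK in Gv.
  by move=> -[Fx Gv]; split => //; rewrite bK.
exists E.
  rewrite predeqE => x; split => // _.
  have [i _ Fi] : (\bigcup_k F k) (thead x) by rewrite -TF.
  have [j _ Gj] : (\bigcup_k G k) [tuple of behead x] by rewrite -TG.
  exists (maxn i j) => //; split.
    by move: Fi; exact/subsetPset/ndF/leq_maxl.
  by move: Gj; exact/subsetPset/ndG/leq_maxr.
move=> k; have [mF Fk] := Foo k; have [mG Gk] := Goo k; split.
  rewrite (_ : E k = (fun x : Rd R n.+1 => thead x) @^-1` F k `&`
      (fun x : Rd R n.+1 => [tuple of behead x]) @^-1` G k)//.
  apply: measurableI; rewrite -[X in measurable X]setTI.
    exact: measurable_tnth.
  exact: measurable_behead.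
rewrite /lebesgue_cons /pushforward EE product_measure1E//.
by rewrite lte_mul_pinfty// ge0_fin_numE.
Qed.

HB.instance Definition _ := Measure_isSigmaFinite.Build _ _ _
  lebesgue_cons lebesgue_cons_sigma_finite.

End lebesgue_cons.

Fixpoint lebesgue_Rd {R : realType} (n : nat) :
    {sigma_finite_measure set (Rd R n) -> \bar R} :=
  match n with
  | 0 => dirac [tuple]
  | n'.+1 => lebesgue_cons (lebesgue_Rd n')
  end.
Arguments lebesgue_Rd R n : clear implicits.

Lemma lebesgue_Rd_box (R : realType) (n : nat)
    (A : 'I_n -> set (measurableTypeR R)) : (forall i, measurable (A i)) ->
  lebesgue_Rd R n [set x | forall i, A i (tnth x i)] =
  (\prod_(i < n) lebesgue_measure (A i))%E.
Proof.
elim: n A => [A _|n IHn A mA] /=.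
  by rewrite big_ord0 diracE mem_set// => -[].
rewrite big_ord_recl -IHn// /lebesgue_cons /pushforward.
rewrite -product_measure1E//; last first.
  rewrite (_ : [set _ | _] = \bigcap_(i in [set: 'I_n])
      ((fun x : Rd R n => tnth x i) @^-1` (A (lift ord0 i)))); last first.
    by apply/seteqP; split => x /= Ax i; [move=> _|]; exact: Ax.
  apply: fin_bigcap_measurable => // i _; rewrite -[X in measurable X]setTI.
  exact: measurable_tnth.
congr (_ _); apply/seteqP; split => -[x v] /=.
  move=> Axv; split; first exact: (Axv ord0).
  by move=> i; have := Axv (lift ord0 i); rewrite tnthS.
move=> [Ax Av] i; case: (unliftP ord0 i) => [j ->|->] //.
by rewrite tnthS; exact: Av.
Qed.

Section optimal_transport.
Local Open Scope ereal_scope.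
Context {R : realType}.

Definition coupling dT (T : measurableType dT) dU (U : measurableType dU)
    (mu : probability T R) (nu : probability U R)
    (gamma : probability (T * U)%type R) : Prop :=
  (forall A, measurable A -> pushforward gamma fst A = mu A) /\
  (forall B, measurable B -> pushforward gamma snd B = nu B).

Definition wasserstein2 dT (T : measurableType dT) (dist : T -> T -> R)
    (mu nu : probability T R) : \bar R :=
  ereal_inf [set \int[gamma]_p (dist p.1 p.2 ^+ 2)%:E
            | gamma in coupling mu nu] `^ 2^-1.

Definition transport_cost d (gamma : probability (Rd R d * Rd R d)%type R) :
    \bar R :=
  \int[gamma]_p (2^-1 * euclid_dist p.1 p.2 ^+ 2)%:E.

Definition optimal_coupling d (mu nu : probability (Rd R d) R)
    (gamma : probability (Rd R d * Rd R d)%type R) : Prop :=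
  coupling mu nu gamma /\
  forall gamma', coupling mu nu gamma' ->
    transport_cost gamma <= transport_cost gamma'.

Definition supported_on d (mu : probability (Rd R d) R) (A : set (Rd R d)) :
  Prop := mu (~` A) = 0.

End optimal_transport.

(* Main.v *)
From HB Require Import structures.
Require Import Defs.
From mathcomp Require Import all_boot all_order all_algebra.
From mathcomp Require Import all_classical all_reals all_analysis.
From mathcomp Require Import measurable_realfun ring lra.
Set Implicit Arguments.
Unset Strict Implicit.
Unset Printing Implicit Defensive.
Import Order.TTheory GRing.Theory Num.Theory.
Local Open Scope classical_set_scope.
Local Open Scope ring_scope.

(** Let gamma and gamma' be optimal for (mu, nu) and (mu', nu').  Kantorovich
    potentials of gamma are a convex Lipschitz function phi and a function psi
    such that <x, y> <= phi x + psi y, with equality gamma-almost everywhere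
    (kantorovich_potentials).  The gap phi x + psi y - <x, y> says how far y is
    from being a subgradient of phi at x.

    The mean gap of gamma' is small.  Bring in the potentials of gamma' too: the
    terms <x, y> cancel, and there remain differences of integrals of Lipschitz
    functions against mu and mu', and against nu and nu', which are at most a
    constant times the sum s of the two Wasserstein distances (duality_gap).

    A small gap brings second coordinates together.  Glue gamma and gamma' along
    an almost optimal coupling of mu and mu' (gluing_dist1), and draw a pair of
    points (x, y), (x', y') from the resulting plan.  Use the dual inequality for
    x + e e_i and y', and for x - e e_i and y, or with both signs exchanged, where
    e_i is the i-th basis vector and e > 0 a step to be chosen, and add:
      e |y_i - y'_i| <= phi (x + e e_i) + phi (x - e e_i) - 2 phi x
                        + gap (x', y') + C |x - x'|.
    The second difference of a Lipschitz function is only O(e) at a given point,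
    but its integral over a cube telescopes and is O(e ^ 2)
    (integral_second_difference).  It is nonnegative because phi is convex, so
    that its integral against mu is O(e ^ 2) as well: mu is at most M times the
    Lebesgue measure.  Hence the mean of |y - y'| is O(s / e + e)
    (plan_estimate).

    With e equal to the square root of s, and since all supports are bounded, the
    mean squared distance under the plan is O(sqrt s).  So the fourth power of
    the distance between gamma and gamma' is O(s), and then so is the eighth
    (plan_stability).

    Potentials are built by Rockafellar's formula, which needs the support of an
    optimal coupling to be cyclically monotone: otherwise an exchange of mass
    along a cycle (swap_coupling) would lower the cost. *)

(** * Coordinates and the l1 distance *)

Section coordinates.
Context {R : realType} {d : nat}.
Implicit Types (x y z : Rd R d).

Definition dot x y : R := \sum_(i < d) tnth x i * tnth y i.

(** The sum over coordinates lets each axis be treated separately; passing from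
    the Euclidean distance costs a dimensional constant. *)
Definition dist1 x y : R := \sum_(i < d) `|tnth x i - tnth y i|.

(** Cubes stand in for balls: only bounds on coordinates matter below. *)
Definition cube (r : R) : set (Rd R d) := [set x | forall i, `|tnth x i| < r].

Definition coord_shift (i : 'I_d) (e : R) x : Rd R d :=
  [tuple tnth x j + (j == i)%:R * e | j < d].

Lemma dist1_ge0 x y : 0 <= dist1 x y.
Proof. by apply: sumr_ge0. Qed.

Lemma dist1C x y : dist1 x y = dist1 y x.
Proof. by apply: eq_bigr => i _; rewrite distrC. Qed.

Lemma dist1_shift i e x : dist1 (coord_shift i e x) x = `|e|.
Proof.
rewrite /dist1 (bigD1 i)//= big1 => [|j ji]; rewrite tnth_mktuple.
  by rewrite eqxx mul1r addr0 addrC addKr.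
by rewrite (negbTE ji) mul0r addr0 subrr normr0.
Qed.

Lemma dot_shift i e x y : dot (coord_shift i e x) y = dot x y + e * tnth y i.
Proof.
rewrite /dot (bigD1 i)//= [X in _ = X + _](bigD1 i)//= tnth_mktuple eqxx mul1r.
rewrite mulrDl -!addrA; congr (_ + _); rewrite addrC; congr (_ + _).
by apply: eq_bigr => j ji; rewrite tnth_mktuple (negbTE ji) mul0r addr0.
Qed.

Lemma dotC x y : dot x y = dot y x.
Proof. by apply: eq_bigr => i _; rewrite mulrC. Qed.

Lemma dot_lipschitz r x x' y : 0 <= r -> (forall i, `|tnth y i| <= r) ->
  `|dot x y - dot x' y| <= r * dist1 x x'.
Proof.
move=> r0 yr; rewrite /dot -sumrB mulr_sumr; apply: (le_trans (ler_norm_sum _ _ _)).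
apply: ler_sum => i _; rewrite -mulrBl normrM mulrC; exact: ler_wpM2r.
Qed.

Lemma euclid_dist_sqr x y :
  euclid_dist x y ^+ 2 = \sum_(i < d) (tnth x i - tnth y i) ^+ 2.
Proof. by rewrite sqr_sqrtr// sumr_ge0// => i _; rewrite sqr_ge0. Qed.

Lemma normB_le_euclid_dist x y i :
  `|tnth x i - tnth y i| <= euclid_dist x y.
Proof.
rewrite -(@ler_pXn2r _ 2)// ?nnegrE ?sqrtr_ge0// euclid_dist_sqr.
rewrite real_normK ?num_real// (bigD1 i)//= lerDl.
by rewrite sumr_ge0// => j _; rewrite sqr_ge0.
Qed.

Lemma euclid_ball_cube r : @euclid_ball R d r `<=` cube r.
Proof.
move=> x xr i; apply: le_lt_trans xr.
by have := normB_le_euclid_dist x (euclid_origin d) i; rewrite tnth_mktuple subr0.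
Qed.

Lemma cubeS r r' : r <= r' -> cube r `<=` cube r'.
Proof. by move=> rr' x xr i; exact: lt_le_trans (xr i) rr'. Qed.

Lemma cube_shift r r' i e x : `|e| + r <= r' -> cube r x -> cube r' (coord_shift i e x).
Proof.
move=> er xr j; rewrite tnth_mktuple; apply: lt_le_trans er.
rewrite (le_lt_trans (ler_normD _ _))// addrC ler_ltD//.
by case: (j == i); rewrite ?mul1r// mul0r normr0.
Qed.

Lemma dist1_le e x y :
  (forall i, `|tnth x i - tnth y i| <= e) -> dist1 x y <= d%:R * e.
Proof.
move=> xye; apply: (le_trans (ler_sum _ (fun i _ => xye i))).
by rewrite sumr_const card_ord mulr_natl.
Qed.

Lemma cube_dist1 r x y : cube r x -> cube r y -> dist1 x y <= d%:R * (2 * r).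
Proof.
move=> xr yr; apply: dist1_le => i; rewrite (le_trans (ler_normB _ _))//.
by rewrite mulr_natl mulr2n lerD// ltW.
Qed.

Lemma dist1_triangle x y z : dist1 x z <= dist1 x y + dist1 y z.
Proof.
rewrite -big_split; apply: ler_sum => i _ /=.
by rewrite (le_trans _ (ler_normD _ _))// addrA subrK.
Qed.

Lemma euclid_dist_sqr_cube r x y : cube r x -> cube r y ->
  euclid_dist x y ^+ 2 <= 2 * r * dist1 x y.
Proof.
move=> xr yr; rewrite euclid_dist_sqr /dist1 mulr_sumr; apply: ler_sum => i _.
rewrite -real_normK ?num_real// expr2 ler_wpM2r// (le_trans (ler_normB _ _))//.
by have := xr i; have := yr i; lra.
Qed.

End coordinates.
Arguments cube {R d}.

Section measurability.
Context {R : realType} {d : nat}.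

Lemma measurable_coord d' (T : measurableType d') (f : T -> Rd R d) i :
  measurable_fun setT f -> measurable_fun setT (fun x => tnth (f x) i).
Proof.
move=> mf; apply: (@measurableT_comp _ _ _ _ _ _ (fun x : Rd R d => tnth x i)) => //.
exact: measurable_tnth.
Qed.

Lemma measurable_dist1 d' (T : measurableType d') (f g : T -> Rd R d) :
  measurable_fun setT f -> measurable_fun setT g ->
  measurable_fun setT (fun x => dist1 (f x) (g x)).
Proof.
move=> mf mg; apply: measurable_sum => i; apply: measurableT_comp => //.
by apply: measurable_funB; exact: measurable_coord.
Qed.

Lemma measurable_dot d' (T : measurableType d') (f g : T -> Rd R d) :
  measurable_fun setT f -> measurable_fun setT g ->
  measurable_fun setT (fun x => dot (f x) (g x)).
Proof.
move=> mf mg; apply: measurable_sum => i.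
by apply: measurable_funM; exact: measurable_coord.
Qed.

Lemma measurable_euclid_dist_sqr d' (T : measurableType d') (f g : T -> Rd R d) :
  measurable_fun setT f -> measurable_fun setT g ->
  measurable_fun setT (fun x => euclid_dist (f x) (g x) ^+ 2).
Proof.
move=> mf mg; under eq_fun do rewrite euclid_dist_sqr.
apply: measurable_sum => i; apply: measurable_funX.
by apply: measurable_funB; exact: measurable_coord.
Qed.

Lemma measurable_shift i e : measurable_fun setT (@coord_shift R d i e).
Proof.
apply/measurable_fun_tnthP => j.
rewrite (_ : _ \o _ = fun x : Rd R d => tnth x j + (j == i)%:R * e); last first.
  by apply/funext => x /=; rewrite tnth_mktuple.
by apply: measurable_funD => //; exact: measurable_coord.
Qed.

Lemma measurable_box (A : 'I_d -> set (measurableTypeR R)) :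
  (forall i, measurable (A i)) ->
  measurable [set x : Rd R d | forall i, A i (tnth x i)].
Proof.
move=> mA; rewrite (_ : [set _ | _] = \bigcap_(i in [set: 'I_d])
    ((fun x : Rd R d => tnth x i) @^-1` A i)); last first.
  by apply/seteqP; split => x /= Ax i; [move=> _|]; exact: Ax.
apply: fin_bigcap_measurable => // i _; rewrite -[X in measurable X]setTI.
exact: measurable_tnth.
Qed.

Lemma measurable_cube_around (a : Rd R d) (r : R) :
  measurable [set x : Rd R d | forall i, `|tnth x i - tnth a i| < r].
Proof.
apply: (measurable_box (A := fun i => [set t | `|t - tnth a i| < r])) => i.
rewrite (_ : [set _ | _] = `]tnth a i - r, tnth a i + r[%classic)//.
by apply/seteqP; split => t /=; rewrite in_itv/= ltr_distl.
Qed.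

Lemma measurable_cube (r : R) : measurable (@cube R d r).
Proof.
have := @measurable_cube_around [tuple (0 : R) | i < d] r.
rewrite (_ : [set _ | _] = cube r)//; apply/seteqP.
by split => x /= xr i; have := xr i; rewrite tnth_mktuple subr0.
Qed.

Lemma measurable_euclid_ball (r : R) : measurable (@euclid_ball R d r).
Proof.
have [r0|r0] := ltP 0 r; last first.
  rewrite (_ : @euclid_ball R d r = set0)// -subset0 => x /= xr.
  by have := le_lt_trans (sqrtr_ge0 _) (lt_le_trans xr r0); rewrite ltxx.
have mf : measurable_fun setT (fun x => euclid_dist x (@euclid_origin R d) ^+ 2).
  exact: measurable_euclid_dist_sqr.
rewrite (_ : @euclid_ball R d r =
    setT `&` (fun x => euclid_dist x (@euclid_origin R d) ^+ 2) @^-1` `]-oo, r ^+ 2[).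
  by apply: mf.
rewrite setTI; apply/seteqP; split => x /=;
  by rewrite in_itv/= ltr_pXn2r// nnegrE ?sqrtr_ge0// ltW.
Qed.

Definition rational_point (q : d.-tuple rat) : Rd R d := [tuple ratr (tnth q i) | i < d].

Lemma rational_point_dense (x : Rd R d) (e : R) : 0 < e ->
  exists q, forall i, `|tnth x i - tnth (rational_point q) i| < e.
Proof.
move=> e0.
have /choice[f fP] : forall i : 'I_d, exists q : rat, `|tnth x i - ratr q| < e.
  move=> i; have /rat_in_itvoo[q] : tnth x i - e < tnth x i + e.
    by rewrite ltrD2l gtrN.
  by rewrite in_itv/= => qe; exists q; rewrite distrC ltr_distl.
by exists [tuple f i | i < d] => i; rewrite !tnth_mktuple.
Qed.

(** The function f is the supremum of f q - L * dist1 x q over the rational points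
    q, so that its superlevel sets are countable unions. *)
Lemma measurable_lipschitz (L : R) (f : Rd R d -> R) : 0 <= L ->
  (forall x y, `|f x - f y| <= L * dist1 x y) -> measurable_fun setT f.
Proof.
move=> L0 fL.
apply: (measurability _ (@RGenOInfty.measurableE R)) => //.
move=> /= _ [_ [a ->] <-]; rewrite setTI.
rewrite (_ : _ @^-1` _ = \bigcup_q
    [set x | a < f (rational_point q) - L * dist1 x (rational_point q)]).
  apply: countable_bigcupT_measurable => // q.
  have mh : measurable_fun setT
      (fun x => f (rational_point q) - L * dist1 x (rational_point q)).
    apply: measurable_funB => //; apply: measurable_funM => //.
    exact: measurable_dist1.
  rewrite (_ : [set x | _] = setT `&` (fun x =>
      f (rational_point q) - L * dist1 x (rational_point q)) @^-1` `]a, +oo[).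
    exact: mh.
  by rewrite setTI; apply/seteqP; split => x /=; rewrite in_itv/= andbT.
apply/seteqP; split => [x /=|x /= [q _ /=]]; rewrite in_itv/= andbT; last first.
  move=> /lt_le_trans; apply; rewrite lerBlDr -lerBlDl dist1C.
  exact: le_trans (ler_norm _) (fL _ _).
move=> afx; pose e := (f x - a) / (2 * (L + 1) * (d%:R + 1)).
have e0 : 0 < e.
  by rewrite divr_gt0 ?subr_gt0// !mulr_gt0// ltr_wpDl.
have [q qe] := rational_point_dense x e0; exists q => //=.
have xq : dist1 x (rational_point q) <= d%:R * e.
  by apply: dist1_le => i; rewrite ltW.
have fq : f x - f (rational_point q) <= L * dist1 x (rational_point q).
  exact: le_trans (ler_norm _) (fL _ _).
have ee : e * (2 * (L + 1) * (d%:R + 1)) = f x - a.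
  by rewrite /e divfK// gt_eqF// !mulr_gt0// ltr_wpDl.
have Lx : L * dist1 x (rational_point q) <= L * (d%:R * e) by exact: ler_wpM2l.
have : 2 * (L * (d%:R * e)) < f x - a.
  rewrite -ee; have d0 : 0 <= d%:R :> R by [].
  have : 0 < e * L + e * d%:R + e by rewrite ltr_wpDl// addr_ge0// mulr_ge0// ltW.
  by lra.
by lra.
Qed.

End measurability.

(** * Real integrals, image measures, sums of restrictions *)

Section expectation.
Context d (T : measurableType d) (R : realType) (P : probability T R).
Implicit Types f g : T -> R.

(** Functions of points in bounded supports are bounded almost everywhere, hence
    integrable, and real integrals obey simpler rules than extended real ones. *)
Definition integrableR f := P.-integrable setT (EFin \o f).

Lemma integrableR_bounded (K : R) f : measurable_fun setT f ->
  {ae P, forall x, `|f x| <= K} -> integrableR f.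
Proof.
move=> mf fK; apply/integrableP; split; first exact/measurable_EFinP.
have K0 : (0 <= `|K|%:E)%E by rewrite lee_fin.
apply: (@le_lt_trans _ _ (\int[P]_(x in setT) `|K|%:E)%E); last first.
  have := finite_measure_integrable_cst P `|K| measurableT.
  exact: integrable_lty.
apply: ae_ge0_le_integral => //.
- by apply: measurableT_comp => //; exact/measurable_EFinP.
- apply: filterS fK => x fx _ /=; rewrite lee_fin.
  exact: le_trans fx (ler_norm _).
Qed.

Lemma integrableRD f g : integrableR f -> integrableR g ->
  integrableR (fun x => f x + g x).
Proof. exact: integrableD. Qed.

Lemma integrableRB f g : integrableR f -> integrableR g ->
  integrableR (fun x => f x - g x).
Proof. exact: integrableB. Qed.

Lemma integrableRZ (k : R) f : integrableR f -> integrableR (fun x => k * f x).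
Proof. exact: integrableZl. Qed.

Lemma integrableR_cst (k : R) : integrableR (fun=> k).
Proof. exact: finite_measure_integrable_cst. Qed.

Lemma integrableR_sum I (r : seq I) (h : I -> T -> R) :
  (forall i, integrableR (h i)) -> integrableR (fun x => \sum_(i <- r) h i x).
Proof.
move=> hi; rewrite /integrableR; have := @integrable_sum _ _ _ P setT measurableT I r xpredT
  (fun i => EFin \o h i) (fun i _ => hi i).
by apply: eq_integrable => // x _ /=; rewrite sumEFin.
Qed.

Lemma measurable_integrableR f : integrableR f -> measurable_fun setT f.
Proof. by move=> /integrableP[/measurable_EFinP]. Qed.

Lemma EFin_Rintegral f : integrableR f ->
  (\int[P]_x f x)%:E = (\int[P]_x (f x)%:E)%E.
Proof. by move=> fi; rewrite fineK//; exact: integrable_fin_num. Qed.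

Lemma Rintegral_sum I (r : seq I) (h : I -> T -> R) :
  (forall i, integrableR (h i)) ->
  \int[P]_x (\sum_(i <- r) h i x) = \sum_(i <- r) \int[P]_x h i x.
Proof.
move=> hi; elim: r => [|i r IHr].
  rewrite big_nil (eq_Rintegral _ (g := fun=> 0)) => [|x _]; last by rewrite big_nil.
  by rewrite Rintegral_cst// mul0r.
rewrite big_cons -IHr -(RintegralD _ (hi i) (integrableR_sum r hi))//.
by apply: eq_Rintegral => x _; rewrite big_cons.
Qed.

Lemma Rintegral_prob_cst (k : R) : \int[P]_x k = k.
Proof. rewrite Rintegral_cst// [X in fine X](_ : _ = 1%E) ?mulr1//.
exact: probability_setT. Qed.

Lemma ae_eq_Rintegral f g : measurable_fun setT f -> measurable_fun setT g ->
  {ae P, forall x, f x = g x} -> \int[P]_x f x = \int[P]_x g x.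
Proof.
move=> mf mg fg; congr fine; apply: ae_eq_integral => //;
  try exact/measurable_EFinP.
by apply: filterS fg => x -> _.
Qed.

Lemma ae_le_Rintegral f g : integrableR f -> integrableR g ->
  {ae P, forall x, f x <= g x} -> \int[P]_x f x <= \int[P]_x g x.
Proof.
move=> fi gi fg; rewrite -subr_ge0 -RintegralB//.
have mf := measurable_integrableR fi; have mg := measurable_integrableR gi.
rewrite (@ae_eq_Rintegral _ (fun x => Num.max (g x - f x) 0)).
- by apply: Rintegral_ge0 => x _; rewrite le_max lexx orbT.
- exact: measurable_funB.
- by apply: measurable_maxr => //; exact: measurable_funB.
- by apply: filterS fg => x fgx; rewrite max_l// subr_ge0.
Qed.

Lemma ae_of_probability0 A : measurable A -> P (~` A) = 0%E -> {ae P, forall x, A x}.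
Proof. by move=> mA PA; exists (~` A); split => //; exact: measurableC. Qed.

End expectation.

Section iterated_projections.
Context d (T : measurableType d).
Let T4 := ((T * T) * (T * T))%type.

Lemma measurable_fst_fst : measurable_fun setT (fun z : T4 => z.1.1).
Proof. exact: (measurableT_comp measurable_fst measurable_fst). Qed.

Lemma measurable_snd_fst : measurable_fun setT (fun z : T4 => z.1.2).
Proof. exact: (measurableT_comp measurable_snd measurable_fst). Qed.

Lemma measurable_fst_snd : measurable_fun setT (fun z : T4 => z.2.1).
Proof. exact: (measurableT_comp measurable_fst measurable_snd). Qed.

Lemma measurable_snd_snd : measurable_fun setT (fun z : T4 => z.2.2).
Proof. exact: (measurableT_comp measurable_snd measurable_snd). Qed.

End iterated_projections.
Arguments measurable_fst_fst {d T}.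
Arguments measurable_snd_fst {d T}.
Arguments measurable_fst_snd {d T}.
Arguments measurable_snd_snd {d T}.

(** If h maps P to Q then facts about Q pull back along h; the marginals of a
    coupling are the case of a projection. *)
Section image_measure.
Context d (T : measurableType d) d' (U : measurableType d') (R : realType).
Variables (P : probability T R) (Q : probability U R) (h : T -> U).
Hypotheses (mh : measurable_fun setT h)
  (hPQ : forall A, measurable A -> pushforward P h A = Q A).

Lemma ae_image (A : U -> Prop) : {ae Q, forall y, A y} -> {ae P, forall x, A (h x)}.
Proof.
move=> [N [mN QN sub]]; exists (h @^-1` N); split.
- by rewrite -[X in measurable X]setTI; exact: mh.
- by rewrite -QN -hPQ.
- by move=> x /= nA; apply: sub.
Qed.

Lemma ge0_integral_image (f : U -> \bar R) : measurable_fun setT f ->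
  (forall y, 0 <= f y)%E -> (\int[P]_x f (h x) = \int[Q]_y f y)%E.
Proof.
move=> mf f0; transitivity (\int[pushforward P h]_y f y)%E.
  by rewrite ge0_integral_pushforward.
by apply: eq_measure_integral => A mA _; exact: hPQ.
Qed.

Lemma integrableR_image (f : U -> R) :
  integrableR Q f -> integrableR P (fun x => f (h x)).
Proof.
move=> /integrableP[mf fi]; apply/integrableP; split.
  exact: (measurableT_comp mf mh).
apply: le_lt_trans fi; rewrite -(@ge0_integral_image (fun x => `|(f x)%:E|%E))//.
exact: measurableT_comp.
Qed.

Lemma Rintegral_image (f : U -> R) :
  integrableR Q f -> \int[P]_x f (h x) = \int[Q]_y f y.
Proof.
move=> fi; congr fine; transitivity (\int[pushforward P h]_y (f y)%:E)%E.
  rewrite integral_pushforward//.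
  - by move/integrableP : fi => [].
  - exact: integrableR_image.
by apply: eq_measure_integral => A mA _; exact: hPQ.
Qed.

End image_measure.

Lemma measure_pushforward d (T : measurableType d) d' (U : measurableType d')
    (R : realType) (m : {measure set T -> \bar R}) (f : T -> U) :
  measurable_fun setT f ->
  exists M : {measure set U -> \bar R}, M = pushforward m f :> (set U -> \bar R).
Proof. by move=> mf; unshelve eexists (pushforward m f). Qed.

Section weighted_restrictions.
Local Open Scope ereal_scope.
Context d (T : measurableType d) (R : realType).

Lemma integral_mrestr (m : {measure set T -> \bar R}) (D : set T)
    (mD : measurable D) (f : T -> \bar R) : measurable_fun setT f ->
  (forall x, 0 <= f x) -> \int[mrestr m mD]_x f x = \int[m]_(x in D) f x.
Proof.
move=> mf f0; rewrite (@ge0_negligible_integral _ _ _ (mrestr m mD) _ (~` D))//.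
- rewrite setTD setCK; apply: eq_measure_integral => A mA AD.
  by rewrite /= /mrestr setIidl.
- exact: measurableC.
- by rewrite /= /mrestr setICl measure0.
Qed.

Lemma measure_sum (I : finType) (m : I -> {measure set T -> \bar R}) :
  exists M : {measure set T -> \bar R},
    (forall A, M A = \sum_i m i A) /\
    forall f, measurable_fun setT f -> (forall x, 0 <= f x) ->
      \int[M]_x f x = \sum_i \int[m i]_x f x.
Proof.
pose m_ n : {measure set T -> \bar R} :=
  nth (mzero : {measure set T -> \bar R}) [seq m i | i <- enum I] n.
have m_E (F : {measure set T -> \bar R} -> \bar R) :
    \sum_(k < #|I|) F (m_ k) = \sum_i F (m i).
  rewrite -(big_mkord xpredT (fun k => F (m_ k))) -big_enum/= cardE.
  by rewrite -(size_map m) -(big_map m xpredT F) (big_nth (mzero : {measure set T -> \bar R})).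
exists (msum m_ #|I|); split => [A|f mf f0].
  exact: (m_E (fun u => u A)).
rewrite ge0_integral_measure_sum//.
exact: (m_E (fun u : {measure set T -> \bar R} => \int[u]_x f x)).
Qed.

(** The competitor in the proof of cyclic monotonicity and the glued coupling are
    both assembled from measures of this form. *)
Lemma measure_weighted_restrictions (I : finType) (m : {measure set T -> \bar R})
    (w : I -> R) (D : I -> set T) :
  (forall i, 0 <= w i)%R -> (forall i, measurable (D i)) ->
  exists M : {measure set T -> \bar R},
    (forall A, M A = \sum_i (w i)%:E * m (A `&` D i)) /\
    forall f, measurable_fun setT f -> (forall x, 0 <= f x) ->
      \int[M]_x f x = \sum_i (w i)%:E * \int[m]_(x in D i) f x.
Proof.
move=> w0 mD.
have [M [ME MI]] := measure_sum (fun i => mscale (NngNum (w0 i)) (mrestr m (mD i))).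
exists M; split => [A|f mf f0]; first by rewrite ME.
rewrite MI//; apply: eq_bigr => i _.
by rewrite ge0_integral_mscale//= integral_mrestr.
Qed.

Lemma probability_of_measure (m : {measure set T -> \bar R}) : m setT = 1 ->
  exists P : probability T R, forall A, P A = m A.
Proof.
move=> m1; exists (mnormalize m \d_point) => A.
by rewrite /= /mnormalize m1 onee_eq0/= invr1 mule1.
Qed.

End weighted_restrictions.

(** * Gluing of couplings *)

Lemma measurable_finite_range d (T : measurableType d) (R : realType)
    (I : finType) (c : T -> I) (h : I -> R) :
  (forall i, measurable (c @^-1` [set i])) -> measurable_fun setT (h \o c).
Proof.
move=> mc _ A mA; rewrite setTI.
rewrite (_ : _ @^-1` A = \bigcup_(i in [set i | A (h i)]) c @^-1` [set i]).
  by apply: fin_bigcup_measurable => // i _; exact: finite_finset.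
by apply/seteqP; split => [x Ax|x [i Ai /= ->]//]; exists (c x).
Qed.

Section finite_partition.
Local Open Scope ereal_scope.
Context d (T : measurableType d) (R : realType) (I : finType) (c : T -> I).
Hypothesis mc : forall i, measurable (c @^-1` [set i]).

Lemma integral_finite_partition (m : {measure set T -> \bar R}) (E : set T)
    (f : T -> \bar R) : measurable E -> measurable_fun setT f ->
    (forall x, 0 <= f x) ->
  \int[m]_(x in E) f x = \sum_i \int[m]_(x in E `&` c @^-1` [set i]) f x.
Proof.
move=> mE mf f0; pose F i := E `&` c @^-1` [set i].
have FE : \big[setU/set0]_(i <- index_enum I) F i = E.
  rewrite -bigcup_seq; apply/seteqP; split => [x [i _ []]//|x Ex].
  by exists (c x) => //=; rewrite mem_index_enum.
rewrite -{1}FE ge0_integral_bigsetU//.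
- by move=> i; exact: measurableI.
- exact: index_enum_uniq.
- by move=> i j _ _ [x [[_ /= <-] [_ /= <-]]].
- exact: measurable_funTS.
Qed.

Lemma measure_finite_partition (m : {measure set T -> \bar R}) (E : set T) :
  measurable E -> m E = \sum_i m (E `&` c @^-1` [set i]).
Proof.
move=> mE; have := @integral_finite_partition m E (cst 1) mE (measurable_cst _)
  (fun=> lee01).
rewrite integral_cst// mul1e => ->; apply: eq_bigr => i _.
by rewrite integral_cst ?mul1e//; exact: measurableI.
Qed.

Lemma integral_finite_range (m : {measure set T -> \bar R}) (h : I -> R) :
  (forall i, 0 <= h i)%R ->
  \int[m]_x (h (c x))%:E = \sum_i (h i)%:E * m (c @^-1` [set i]).
Proof.
move=> h0; rewrite (@integral_finite_partition m setT)//.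
- apply: eq_bigr => i _; rewrite setTI -integral_cst//.
  by apply: eq_integral => x /[!inE]/= ->.
- exact/measurable_EFinP/(measurable_finite_range h mc).
- by move=> x; rewrite lee_fin.
Qed.

End finite_partition.


Section gluing.
Local Open Scope ereal_scope.
Context dS (S : measurableType dS) dS' (S' : measurableType dS')
  dX (X : measurableType dX) (R : realType).
Variables (P : probability S R) (Q : probability S' R)
  (sigma : probability (X * X)%type R) (f : S -> X) (g : S' -> X).
Hypotheses (mf : measurable_fun setT f) (mg : measurable_fun setT g).
Hypothesis sigma1 : forall A, measurable A -> pushforward sigma fst A = P (f @^-1` A).
Hypothesis sigma2 : forall A, measurable A -> pushforward sigma snd A = Q (g @^-1` A).
Variables (I : finType) (c : X -> I).
Hypothesis mc : forall i, measurable (c @^-1` [set i]).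

Let A i := f @^-1` (c @^-1` [set i]).
Let B i := g @^-1` (c @^-1` [set i]).
Let AB ij := A ij.1 `*` B ij.2.
Let S2 ij := (c @^-1` [set ij.1]) `*` (c @^-1` [set ij.2]).

Let mA i : measurable (A i).
Proof. by rewrite -[A i]setTI; exact: mf. Qed.

Let mB i : measurable (B i).
Proof. by rewrite -[B i]setTI; exact: mg. Qed.

Let mAB ij : measurable (AB ij). Proof. exact: measurableX. Qed.

Let mS2 ij : measurable (S2 ij). Proof. exact: measurableX. Qed.

Let p i := fine (P (A i)).
Let q i := fine (Q (B i)).
Let s ij := fine (sigma (S2 ij)).
Let w ij : R := (s ij / (p ij.1 * q ij.2))%R.

Let pE i : P (A i) = (p i)%:E.
Proof. by rewrite fineK// fin_num_measure. Qed.

Let qE i : Q (B i) = (q i)%:E.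
Proof. by rewrite fineK// fin_num_measure. Qed.

Let sE i : sigma (S2 i) = (s i)%:E.
Proof. by rewrite fineK// fin_num_measure. Qed.

Let p0 i : (0 <= p i)%R. Proof. exact: fine_ge0. Qed.
Let q0 i : (0 <= q i)%R. Proof. exact: fine_ge0. Qed.
Let s0 i : (0 <= s i)%R. Proof. exact: fine_ge0. Qed.
Let w0 ij : (0 <= w ij)%R.
Proof. by rewrite divr_ge0// mulr_ge0. Qed.

Let sum_s1 i : (\sum_j s (i, j) = p i)%R.
Proof.
apply: EFin_inj; rewrite -pE -sigma1// -sumEFin.
rewrite /pushforward (@measure_finite_partition _ _ _ _ (c \o snd)).
- by apply: eq_bigr => j _; rewrite -sE.
- by move=> j; rewrite comp_preimage -[X in measurable X]setTI; exact: measurable_snd.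
- by rewrite -[X in measurable X]setTI; exact: measurable_fst.
Qed.

Let sum_s2 j : (\sum_i s (i, j) = q j)%R.
Proof.
apply: EFin_inj; rewrite -qE -sigma2// -sumEFin.
rewrite /pushforward (@measure_finite_partition _ _ _ _ (c \o fst)).
- by apply: eq_bigr => i _; rewrite -sE setIC.
- by move=> j'; rewrite comp_preimage -[X in measurable X]setTI; exact: measurable_fst.
- by rewrite -[X in measurable X]setTI; exact: measurable_snd.
Qed.

Let wE i j : (w (i, j) * (p i * q j) = s (i, j))%R.
Proof.
rewrite /w/=; have [pq0|pq0] := eqVneq (p i * q j)%R 0%R; last by rewrite divfK.
rewrite pq0 mulr0; apply/esym/eqP; rewrite eq_le s0 andbT.
move/eqP : pq0; rewrite mulf_eq0 => /orP[/eqP <-|/eqP <-].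
  by rewrite -sum_s1 (bigD1 j)//= lerDl sumr_ge0.
by rewrite -sum_s2 (bigD1 i)//= lerDl sumr_ge0.
Qed.

(** Exact gluing would disintegrate P along f and Q along g.  It is enough to
    control the cells that contain the two points, and this needs no
    disintegration: reweight the product of P and Q on each product of cells so
    that the pair of cells has the same law as under sigma.  Inside the cells the
    two points remain independent. *)
Lemma gluing : exists Pi : probability (S * S')%type R, coupling P Q Pi /\
  forall h : I * I -> R, (forall ij, 0 <= h ij)%R ->
    \int[Pi]_z (h (c (f z.1), c (g z.2)))%:E =
    \int[sigma]_z (h (c z.1, c z.2))%:E.
Proof.
have [M [ME _]] := measure_weighted_restrictions (P \x Q) w0 mAB.
(* A cell without mass meets no mass of sigma either, so the value of a division
   by zero does not matter. *)
have wq i j : (w (i, j) * q j)%R = (s (i, j) / p i)%R.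
  rewrite /w/= invfM mulrA; have [qj0|qj0] := eqVneq (q j) 0%R; last by rewrite mulfVK.
  suff -> : s (i, j) = 0%R by rewrite !mul0r.
  by apply/eqP; rewrite eq_le s0 -qj0 -sum_s2 (bigD1 i)//= lerDl sumr_ge0.
have wp i j : (w (i, j) * p i)%R = (s (i, j) / q j)%R.
  rewrite /w/= invfM mulrA mulrAC.
  have [pi0|pi0] := eqVneq (p i) 0%R; last by rewrite mulfVK.
  suff -> : s (i, j) = 0%R by rewrite !mul0r.
  by apply/eqP; rewrite eq_le s0 -pi0 -sum_s1 (bigD1 j)//= lerDl sumr_ge0.
have M1 E : measurable E -> M (E `*` setT) = P E.
  move=> mE; rewrite ME (measure_finite_partition mA P mE).
  rewrite -(pair_bigA _ (fun i j => (w (i, j))%:E * (P \x Q) (E `*` setT `&` AB (i, j))))/=.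
  apply: eq_bigr => i _; rewrite -/(A i).
  have mEA : measurable (E `&` A i) by exact: measurableI.
  rewrite (eq_bigr (fun j => (fine (P (E `&` A i)) * (s (i, j) / p i))%:E)); last first.
    move=> j _; rewrite /AB -setXI setTI product_measure1E//= qE.
    have -> : P (E `&` A i) = (fine (P (E `&` A i)))%:E by rewrite fineK// fin_num_measure.
    by rewrite -!EFinM -wq mulrCA.
  rewrite sumEFin -mulr_sumr -mulr_suml sum_s1.
  have [pi0|pi0] := eqVneq (p i) 0%R; last by rewrite divff// mulr1 fineK ?fin_num_measure.
  rewrite pi0 mul0r mulr0; apply/esym/eqP; rewrite eq_le measure_ge0 andbT -pi0 -pE.
  by apply: le_measure; rewrite ?inE//; exact: subIsetr.
have M2 E : measurable E -> M (setT `*` E) = Q E.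
  move=> mE; rewrite ME (measure_finite_partition mB Q mE).
  rewrite -(pair_bigA _ (fun i j => (w (i, j))%:E * (P \x Q) (setT `*` E `&` AB (i, j))))/=.
  rewrite exchange_big/=; apply: eq_bigr => j _; rewrite -/(B j).
  have mEB : measurable (E `&` B j) by exact: measurableI.
  rewrite (eq_bigr (fun i => (fine (Q (E `&` B j)) * (s (i, j) / q j))%:E)); last first.
    move=> i _; rewrite /AB -setXI setTI product_measure1E//= pE.
    have -> : Q (E `&` B j) = (fine (Q (E `&` B j)))%:E by rewrite fineK// fin_num_measure.
    by rewrite -!EFinM -wp mulrA mulrC.
  rewrite sumEFin -mulr_sumr -mulr_suml sum_s2.
  have [qj0|qj0] := eqVneq (q j) 0%R; last by rewrite divff// mulr1 fineK ?fin_num_measure.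
  rewrite qj0 mul0r mulr0; apply/esym/eqP; rewrite eq_le measure_ge0 andbT -qj0 -qE.
  by apply: le_measure; rewrite ?inE//; exact: subIsetr.
have [Pi PiE] : exists Pi : probability (S * S')%type R, forall E, Pi E = M E.
  by apply: probability_of_measure; rewrite -setXTT M1// probability_setT.
exists Pi; split.
  split=> E mE; rewrite /pushforward PiE.
    by rewrite -M1// -[fst @^-1` E]setIT; congr (M _); apply/seteqP; split => x [].
  by rewrite -M2// -[snd @^-1` E]setTI; congr (M _); apply/seteqP; split => x [].
move=> h h0.
have mcc ij : measurable ((fun z : S * S' => (c (f z.1), c (g z.2))) @^-1` [set ij]).
  rewrite (_ : _ @^-1` _ = AB ij)//.
  by apply/seteqP; split => -[x y]; rewrite /AB/=; [move=> <-|move=> [/= -> ->]; case: ij].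
have mcs ij : measurable ((fun z : X * X => (c z.1, c z.2)) @^-1` [set ij]).
  rewrite (_ : _ @^-1` _ = S2 ij)//.
  by apply/seteqP; split => -[x y]; rewrite /S2/=; [move=> <-|move=> [/= -> ->]; case: ij].
rewrite (integral_finite_range mcc)// (integral_finite_range mcs)//.
apply: eq_bigr => -[i j] _; congr (_ * _).
rewrite (_ : _ @^-1` _ = AB (i, j)); last first.
  by apply/seteqP; split => -[x y]; rewrite /AB/=; [move=> [<- <-]|move=> [/= -> ->]].
rewrite (_ : (fun z : X * X => _) @^-1` _ = S2 (i, j)); last first.
  by apply/seteqP; split => -[x y]; rewrite /S2/=; [move=> [<- <-]|move=> [/= -> ->]].
rewrite [LHS](PiE (AB (i, j))) ME (bigD1 (i, j))//= big1 => [|[k l] kl].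
  rewrite adde0 setIid product_measure1E//= pE qE sE -!EFinM; congr EFin.
  exact: wE.
rewrite (_ : _ `&` _ = set0) ?measure0 ?mule0// -subset0 => -[x y] [[/= xi yj] [/= xk yl]].
by move/negP: kl; apply; rewrite -xi -yj xpair_eqE; apply/andP; split; apply/eqP.
Qed.

End gluing.

Section cells.
Context {R : realType} {d : nat}.

(** The cell of a point records how each coordinate compares with the nodes of a
    grid of step h, which makes cells finite in number and measurable. *)
Lemma cube_partition (r k : R) : 0 < r -> 0 < k ->
  exists (I : finType) (c : Rd R d -> I),
    (forall i, measurable (c @^-1` [set i])) /\
    forall x y, cube r x -> cube r y -> c x = c y -> dist1 x y <= k.
Proof.
move=> r0 k0; pose h := k / (d%:R + 1); have h0 : 0 < h by rewrite divr_gt0// ltr_wpDl.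
pose n := (Num.truncn (2 * r / h)).+2.
pose t (j : nat) : R := - r + j%:R * h.
pose c (x : Rd R d) : {ffun 'I_d * 'I_n -> bool} := [ffun ij : 'I_d * 'I_n => tnth x ij.1 < t ij.2].
exists {ffun 'I_d * 'I_n -> bool}, c; split.
  move=> b; rewrite (_ : _ @^-1` _ = \bigcap_(ij in [set: ('I_d * 'I_n)%type])
      [set x : Rd R d | (tnth x ij.1 < t ij.2) = b ij]); last first.
    apply/seteqP; split => [x /= <- ij _ /=|x /= cx]; first by rewrite ffunE.
    by apply/ffunP => ij; rewrite ffunE; exact: cx.
  apply: fin_bigcap_measurable => [|ij _]; first exact: finite_finset.
  have mi : measurable_fun setT (fun x : Rd R d => tnth x ij.1) by exact: measurable_tnth.
  have := @measurable_fun_ltr _ _ _ _ _ _ mi (measurable_cst (t ij.2)).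
  move=> /(_ measurableT [set b ij] I); rewrite setTI; exact.
have main x y (i : 'I_d) : cube r x -> cube r y -> c x = c y ->
    tnth y i - tnth x i <= h.
  move=> /(_ i) xr /(_ i) yr cxy; rewrite leNgt; apply/negP => hxy.
  move: xr yr; rewrite !ltr_norml => /andP[xr1 xr2] /andP[yr1 yr2].
  pose j := (Num.truncn ((tnth x i + r) / h)).+1.
  have tE : t j = - r + ((Num.truncn ((tnth x i + r) / h))%:R + 1) * h.
    by rewrite natr1.
  have xr0 : 0 <= (tnth x i + r) / h by rewrite divr_ge0 ?(ltW h0)//; lra.
  have /andP[j1 j2] := truncn_itv xr0.
  have xtj : tnth x i < t j.
    by move: j2; rewrite ltr_pdivrMr// tE -natr1; lra.
  have tjy : t j <= tnth y i.
    by move: j1; rewrite ler_pdivlMr// tE; lra.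
  have jn : (j < n)%N.
    rewrite /n ltnS /j ltnS; apply: le_truncn; rewrite ler_pM2r ?invr_gt0//; lra.
  have := congr1 (fun b : {ffun 'I_d * 'I_n -> bool} => b (i, Ordinal jn)) cxy.
  by rewrite /c !ffunE/= xtj ltNge tjy.
move=> x y xr yr cxy; apply: (@le_trans _ _ (d%:R * h)).
  by apply: dist1_le => i; rewrite ler_norml lerNl opprB (main x y)//= main.
by rewrite /h mulrCA ler_piMr ?(ltW k0)// ler_pdivrMr ?ltr_wpDl// mul1r lerDl.
Qed.

End cells.

Section gluing_Rd.
Context dS (S : measurableType dS) dS' (S' : measurableType dS')
  (R : realType) (d : nat).
Variables (P : probability S R) (Q : probability S' R)
  (sigma : probability (Rd R d * Rd R d)%type R) (f : S -> Rd R d) (g : S' -> Rd R d).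
Hypotheses (mf : measurable_fun setT f) (mg : measurable_fun setT g).
Hypothesis sigma1 : forall A, measurable A -> pushforward sigma fst A = P (f @^-1` A).
Hypothesis sigma2 : forall A, measurable A -> pushforward sigma snd A = Q (g @^-1` A).

(** Replacing each point by a representative of its cell changes the distance of a
    pair by at most k / 2, once under sigma and once under the glued coupling. *)
Lemma gluing_dist1 (r k : R) : 0 < r -> 0 < k ->
  {ae P, forall x, cube r (f x)} -> {ae Q, forall y, cube r (g y)} ->
  {ae sigma, forall z, cube r z.1 /\ cube r z.2} ->
  exists Pi : probability (S * S')%type R, coupling P Q Pi /\
    \int[Pi]_z dist1 (f z.1) (g z.2) <= \int[sigma]_z dist1 z.1 z.2 + k.
Proof.
move=> r0 k0 Pf Qg sz; have k4 : 0 < k / 4 by rewrite divr_gt0.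
have [I [c [mc cd]]] := cube_partition (d := d) r0 k4.
(* A representative inside the cube exists as soon as the cell meets the cube. *)
have /choice[rep repP] : forall i : I, exists y : Rd R d,
    forall x, cube r x -> c x = i -> cube r y /\ c y = i.
  move=> i; have [[y [yr cy]]|noy] := pselect (exists y, cube r y /\ c y = i).
    by exists y.
  by exists (euclid_origin d) => x xr cx; exfalso; apply: noy; exists x.
pose h (ij : I * I) := dist1 (rep ij.1) (rep ij.2).
have [Pi [PiPQ Pih]] := gluing mf mg sigma1 sigma2 mc.
exists Pi; split => //.
have near_rep x : cube r x -> dist1 x (rep (c x)) <= k / 4.
  move=> xr; have [yr cy] := repP (c x) x xr erefl; exact: cd.
have h1 x y : cube r x -> cube r y -> dist1 x y <= h (c x, c y) + k / 2.
  move=> xr yr; have := dist1_triangle x (rep (c x)) y.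
  have := dist1_triangle (rep (c x)) (rep (c y)) y.
  have := near_rep x xr; have := near_rep y yr; rewrite /h/= [dist1 y _]dist1C; lra.
have h2 x y : cube r x -> cube r y -> h (c x, c y) <= dist1 x y + k / 2.
  move=> xr yr; have := dist1_triangle (rep (c x)) x (rep (c y)).
  have := dist1_triangle x y (rep (c y)).
  have := near_rep x xr; have := near_rep y yr; rewrite /h/= [dist1 x (rep _)]dist1C; lra.
have PiC : {ae Pi, forall z, cube r (f z.1) /\ cube r (g z.2)}.
  have Pf' := ae_image measurable_fst PiPQ.1 Pf.
  have Qg' := ae_image measurable_snd PiPQ.2 Qg.
  by apply: filterS2 Pf' Qg'.
have m1 : measurable_fun setT (fun z : S * S' => dist1 (f z.1) (g z.2)).
  by apply: measurable_dist1; exact: measurableT_comp.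
have m2 : measurable_fun setT (fun z : Rd R d * Rd R d => dist1 z.1 z.2).
  exact: measurable_dist1.
have mh1 : measurable_fun setT (fun z : S * S' => h (c (f z.1), c (g z.2))).
  apply: (@measurable_finite_range _ _ _ _ (fun z : S * S' => (c (f z.1), c (g z.2))) h) => -[i j].
  rewrite (_ : _ @^-1` _ = (f @^-1` (c @^-1` [set i])) `*` (g @^-1` (c @^-1` [set j]))).
    apply: measurableX; first by rewrite -[X in measurable X]setTI; exact: mf.
    by rewrite -[X in measurable X]setTI; exact: mg.
  by apply/seteqP; split => -[x y]; [move=> [<- <-]|move=> [/= -> ->]].
have mh2 : measurable_fun setT (fun z : Rd R d * Rd R d => h (c z.1, c z.2)).
  apply: (@measurable_finite_range _ _ _ _ (fun z : Rd R d * Rd R d => (c z.1, c z.2)) h) => -[i j].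
  rewrite (_ : _ @^-1` _ = (c @^-1` [set i]) `*` (c @^-1` [set j])); first exact: measurableX.
  by apply/seteqP; split => -[x y]; [move=> [<- <-]|move=> [/= -> ->]].
have hb x y : cube r x -> cube r y -> `|h (c x, c y)| <= d%:R * (2 * r).
  move=> xr yr; rewrite ger0_norm ?dist1_ge0//.
  by apply: cube_dist1; [have [] := repP (c x) x xr erefl|have [] := repP (c y) y yr erefl].
have db (x y : Rd R d) : cube r x -> cube r y -> `|dist1 x y| <= d%:R * (2 * r).
  by move=> xr yr; rewrite ger0_norm ?dist1_ge0//; exact: cube_dist1.
have i1 : integrableR Pi (fun z => dist1 (f z.1) (g z.2)).
  apply: (@integrableR_bounded _ _ _ _ (d%:R * (2 * r))) => //.
  by apply: filterS PiC => z [z1 z2]; exact: db.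
have i2 : integrableR sigma (fun z => dist1 z.1 z.2).
  apply: (@integrableR_bounded _ _ _ _ (d%:R * (2 * r))) => //.
  by apply: filterS sz => z [z1 z2]; exact: db.
have ih1 : integrableR Pi (fun z => h (c (f z.1), c (g z.2))).
  apply: (@integrableR_bounded _ _ _ _ (d%:R * (2 * r))) => //.
  by apply: filterS PiC => z [z1 z2]; exact: hb.
have ih2 : integrableR sigma (fun z => h (c z.1, c z.2)).
  apply: (@integrableR_bounded _ _ _ _ (d%:R * (2 * r))) => //.
  by apply: filterS sz => z [z1 z2]; exact: hb.
have ik1 := integrableR_cst Pi (k / 2).
have ik2 := integrableR_cst sigma (k / 2).
apply: (@le_trans _ _ (\int[Pi]_z (h (c (f z.1), c (g z.2)) + k / 2))).
  apply: ae_le_Rintegral => //; first exact: integrableRD.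
  by apply: filterS PiC => z [z1 z2]; exact: h1.
rewrite RintegralD// Rintegral_prob_cst.
have -> : \int[Pi]_z h (c (f z.1), c (g z.2)) = \int[sigma]_z h (c z.1, c z.2).
  by congr fine; apply: Pih => ij; exact: dist1_ge0.
apply: (@le_trans _ _ (\int[sigma]_z (dist1 z.1 z.2 + k / 2) + k / 2)).
  rewrite lerD2r; apply: ae_le_Rintegral => //; first exact: integrableRD.
  by apply: filterS sz => z [z1 z2]; exact: h2.
rewrite RintegralD// Rintegral_prob_cst; lra.
Qed.

End gluing_Rd.

(** * Cyclic monotonicity of optimal couplings *)

Section swap.
Local Open Scope ereal_scope.
Context dX (X : measurableType dX) dY (Y : measurableType dY) (R : realType).
Variables (gamma : probability (X * Y)%type R) (n : nat).
Variable s : 'I_n.+1 -> 'I_n.+1.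
Hypothesis s_inj : injective s.
Variables (Q : 'I_n.+1 -> set (X * Y)).
Hypothesis mQ : forall i, measurable (Q i).
Hypothesis Q0 : forall i, 0 < gamma (Q i).

Let g i := fine (gamma (Q i)).
(* At most gamma (Q i) / (n + 1) for each i: the sets Q i may overlap, and gamma
   still covers the total mass that is removed. *)
Let t := ((\prod_i g i) / n.+1%:R)%R.

Let gE i : gamma (Q i) = (g i)%:E.
Proof. by rewrite fineK// fin_num_measure. Qed.

Let g0 i : (0 < g i)%R.
Proof. by rewrite -lte_fin -gE. Qed.

Let g1 i : (g i <= 1)%R.
Proof. by rewrite -lee_fin -gE probability_le1. Qed.

(** A mass tau is taken from each Q i, and the first coordinates taken from
    Q (s i) are paired independently with the second coordinates taken from Q i.
    As s is a bijection, the marginals do not change.  The balance of integrals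
    has no subtraction because the integral of c may be infinite. *)
Lemma swap_coupling :
  exists tau : R, (0 < tau)%R /\ exists gamma' : probability (X * Y)%type R,
   [/\ forall A, measurable A -> gamma' (fst @^-1` A) = gamma (fst @^-1` A),
       forall B, measurable B -> gamma' (snd @^-1` B) = gamma (snd @^-1` B) &
       forall c : X * Y -> \bar R, measurable_fun setT c -> (forall x, 0 <= c x) ->
         \int[gamma']_z c z +
         \sum_i (tau / fine (gamma (Q i)))%:E * \int[gamma]_(z in Q i) c z =
         \int[gamma]_z c z + \sum_i (tau / (fine (gamma (Q (s i))) * fine (gamma (Q i))))%:E *
          \int[gamma \x gamma]_(z in Q (s i) `*` Q i) c (z.1.1, z.2.2)].
Proof.
have t0 : (0 < t)%R by rewrite divr_gt0// prodr_gt0.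
exists t; split => //.
have wt i : (0 <= n.+1%:R^-1 - t / g i)%R.
  rewrite subr_ge0 ler_pdivrMr// mulrC ler_pM2r ?invr_gt0//.
  rewrite (bigD1 i)//= ler_piMr ?(ltW (g0 i))//.
  by apply: prodr_ile1 => j _; rewrite g1 andbT ltW.
pose w1 (bi : bool * 'I_n.+1) : R := if bi.1 then n.+1%:R^-1%R else (n.+1%:R^-1 - t / g bi.2)%R.
pose D1 (bi : bool * 'I_n.+1) := if bi.1 then ~` Q bi.2 else Q bi.2.
have w10 bi : (0 <= w1 bi)%R by case: bi => -[] i; rewrite /w1/=.
have mD1 bi : measurable (D1 bi).
  by case: bi => -[] i; rewrite /D1/=; [exact: measurableC|].
have [M1 [M1E M1I]] := measure_weighted_restrictions gamma w10 mD1.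
pose w2 i : R := (t / (g (s i) * g i))%R.
pose D2 i := Q (s i) `*` Q i.
have w20 i : (0 <= w2 i)%R by apply: divr_ge0; [exact: ltW|apply: mulr_ge0; exact: ltW].
have mD2 i : measurable (D2 i) by exact: measurableX.
have [M2 [M2E M2I]] := measure_weighted_restrictions (gamma \x gamma) w20 mD2.
pose phi (z : (X * Y) * (X * Y)) := (z.1.1, z.2.2).
have mphi : measurable_fun setT phi.
  by apply: measurable_fun_pair; apply: measurableT_comp.
have [M3 M3E] := measure_pushforward M2 mphi.
have splitM1 (F : set (X * Y) -> \bar R) (G : \bar R) :
    (forall i, 0 <= F (Q i)) -> (forall i, 0 <= F (~` Q i)) ->
    (forall i, F (~` Q i) + F (Q i) = G) ->
    \sum_bi (w1 bi)%:E * F (D1 bi) + \sum_i (t / g i)%:E * F (Q i) = G.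
  move=> F0 F0' FG.
  rewrite -(pair_bigA _ (fun b i => (w1 (b, i))%:E * F (D1 (b, i))))/= big_bool/=.
  rewrite -addeA -big_split -big_split/=.
  rewrite (eq_bigr (fun=> n.+1%:R^-1%:E * G)) => [|i _]; last first.
    rewrite /w1 /D1/= -ge0_muleDl ?lee_fin//; last first.
      by rewrite divr_ge0// ltW.
    by rewrite -EFinD subrK -ge0_muleDr// FG.
  rewrite -ge0_sume_distrl => [|i _]; last by rewrite lee_fin.
  rewrite sumEFin sumr_const card_ord -[X in (X%:E)]mulr_natl divff// ?mul1e//.
have add M A : measure_add M1 M A = M1 A + M A by exact: measure_addE.
have muleg i : (g (s i))%:E * (w2 i)%:E = (t / g i)%:E.
  by rewrite -EFinM /w2; congr EFin; field; rewrite !gt_eqF.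
have muleg' i : (g i)%:E * (w2 i)%:E = (t / g (s i))%:E.
  by rewrite -EFinM /w2; congr EFin; field; rewrite !gt_eqF.
pose M := measure_add M1 M3.
have marg1 A : measurable A -> M (fst @^-1` A) = gamma (fst @^-1` A).
  move=> mA; rewrite /M add M3E /pushforward M1E M2E.
  have mA' : measurable (fst @^-1` A : set (X * Y)).
    by rewrite -[X in measurable X]setTI; exact: measurable_fst.
  rewrite -[RHS](splitM1 (fun B => gamma (fst @^-1` A `&` B)))//; last first.
    move=> i; rewrite addeC -measureU//; first last.
    - by rewrite setIACA setICr setI0.
    - by apply: measurableI => //; exact: measurableC.
    - exact: measurableI.
    by rewrite -setIUr setUv setIT.
  congr (_ + _); rewrite [RHS](reindex_inj s_inj)/=; apply: eq_bigr => i _.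
  rewrite (_ : _ `&` _ = (fst @^-1` A `&` Q (s i)) `*` Q i); last first.
    by apply/seteqP; split => -[z z']; rewrite /D2/=; [move=> [a [b b']]|move=> [[a b] b']].
  rewrite product_measure1E//; last exact: measurableI.
  by rewrite muleCA [X in _ * (_ * X)](gE i) [(w2 i)%:E * _]muleC muleg' muleC.
have marg2 A : measurable A -> M (snd @^-1` A) = gamma (snd @^-1` A).
  move=> mA; rewrite /M add M3E /pushforward M1E M2E.
  have mA' : measurable (snd @^-1` A : set (X * Y)).
    by rewrite -[X in measurable X]setTI; exact: measurable_snd.
  rewrite -[RHS](splitM1 (fun B => gamma (snd @^-1` A `&` B)))//; last first.
    move=> i; rewrite addeC -measureU//; first last.
    - by rewrite setIACA setICr setI0.
    - by apply: measurableI => //; exact: measurableC.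
    - exact: measurableI.
    by rewrite -setIUr setUv setIT.
  congr (_ + _); apply: eq_bigr => i _.
  rewrite (_ : _ `&` _ = Q (s i) `*` (snd @^-1` A `&` Q i)); last first.
    by apply/seteqP; split => -[z z']; rewrite /D2/=; [move=> [a [b b']]|move=> [b [a b']]].
  rewrite [X in _ * X = _](@product_measure1E _ _ _ _ _ gamma gamma _ _
    (mQ (s i)) (measurableI _ _ mA' (mQ i))).
  by rewrite muleA [X in _ * X * _](gE (s i)) [(w2 i)%:E * _]muleC muleg.
have [gamma' gamma'E] : exists P : probability (X * Y)%type R, forall A, P A = M A.
  apply: probability_of_measure; rewrite [LHS](marg1 setT measurableT).
  exact: probability_setT.
exists gamma'; split => [A mA|A mA|c mc c0]; rewrite ?gamma'E ?marg1 ?marg2//.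
have -> : \int[gamma']_z c z = \int[M1]_z c z + \int[M3]_z c z.
  rewrite -ge0_integral_measure_add//; apply: eq_measure_integral => A mA _.
  exact: gamma'E.
rewrite M1I//.
have -> : \int[M3]_z c z = \int[M2]_z c (z.1.1, z.2.2).
  by rewrite M3E ge0_integral_pushforward.
rewrite M2I//; last exact: measurableT_comp.
rewrite addeAC; congr (_ + _); apply: (splitM1 (fun B => \int[gamma]_(z in B) c z)).
- by move=> i; exact: integral_ge0.
- by move=> i; exact: integral_ge0.
- move=> i; rewrite -ge0_integral_setU//.
  + by rewrite setUC setUv.
  + exact: measurableC.
  + by rewrite setUC setUv.
  + by rewrite disj_set2E setICl.
Qed.

End swap.

Section cyclic_monotonicity.
Context {R : realType} {d : nat}.
Implicit Types (x y a b : Rd R d) (p z : Rd R d * Rd R d).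

Definition cost x y : R := 2^-1 * euclid_dist x y ^+ 2.

Definition window (rho : R) p : set (Rd R d * Rd R d) :=
  [set x | forall i, `|tnth x i - tnth p.1 i| < rho] `*`
  [set y | forall i, `|tnth y i - tnth p.2 i| < rho].

Lemma measurable_window rho p : measurable (window rho p).
Proof. by apply: measurableX; exact: measurable_cube_around. Qed.

Lemma cost_window rho x y a b : rho <= 1 ->
  (forall i, `|tnth x i - tnth a i| < rho) ->
  (forall i, `|tnth y i - tnth b i| < rho) ->
  `|cost x y - cost a b| <= rho * (2 * (dist1 a b + d%:R)).
Proof.
move=> rho1 xa yb; rewrite /cost !euclid_dist_sqr -mulrBr -sumrB normrM ger0_norm//.
rewrite ler_pdivrMl// mulrCA mulrA; apply: (le_trans (ler_norm_sum _ _ _)).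
have -> : d%:R = \sum_(i < d) (1 : R) by rewrite sumr_const card_ord.
rewrite -big_split/= !mulr_sumr.
apply: ler_sum => i _; have := xa i; have := yb i.
rewrite subr_sqr normrM.
set X := tnth x i; set Y := tnth y i; set A := tnth a i; set B := tnth b i.
move=> YB XA; have h1 : `|X - Y - (A - B)| <= 2 * rho.
  rewrite (_ : X - Y - (A - B) = (X - A) - (Y - B)); last by ring.
  by rewrite (le_trans (ler_normB _ _))//; lra.
have h2 : `|X - Y + (A - B)| <= 2 * (`|A - B| + 1).
  rewrite (_ : X - Y + (A - B) = (X - Y - (A - B)) + 2 * (A - B)); last by ring.
  rewrite (le_trans (ler_normD _ _))// normrM ger0_norm//; lra.
apply: le_trans (ler_pM _ _ h1 h2) _ => //; rewrite le_eqVlt; apply/orP; left.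
by apply/eqP; ring.
Qed.

Lemma cost_ge0 x y : 0 <= cost x y.
Proof. by rewrite mulr_ge0// sqr_ge0. Qed.

Lemma measurable_cost d' (T : measurableType d') (f g : T -> Rd R d) :
  measurable_fun setT f -> measurable_fun setT g ->
  measurable_fun setT (fun t => (cost (f t) (g t))%:E).
Proof.
move=> mf mg; apply/measurable_EFinP; apply: measurable_funM => //.
exact: measurable_euclid_dist_sqr.
Qed.

Lemma cost_dot x y : cost x y = 2^-1 * dot x x + 2^-1 * dot y y - dot x y.
Proof.
rewrite /cost euclid_dist_sqr /dot !mulr_sumr -sumrN -!big_split/=.
by apply: eq_bigr => i _; field.
Qed.

(** Exchanging mass between windows around the points p i does not lower the cost;
    let the windows shrink.  The squared norms in the cost contribute the same to
    both sides, since s is a bijection, and only scalar products remain. *)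
Lemma optimal_cyclically_monotone (mu nu : probability (Rd R d) R)
    (gamma : probability (Rd R d * Rd R d)%type R) (n : nat)
    (s : 'I_n.+1 -> 'I_n.+1) (p : 'I_n.+1 -> Rd R d * Rd R d) :
  optimal_coupling mu nu gamma -> (transport_cost gamma < +oo)%E ->
  injective s -> (forall i rho, 0 < rho -> (0 < gamma (window rho (p i)))%E) ->
  \sum_i dot (p (s i)).1 (p i).2 <= \sum_i dot (p i).1 (p i).2.
Proof.
move=> [[g1 g2] gopt] goo s_inj p0.
pose K i := 2 * (dist1 (p i).1 (p i).2 + d%:R) + 2 * (dist1 (p (s i)).1 (p i).2 + d%:R).
have K0 i : 0 <= K i by rewrite addr_ge0// mulr_ge0// addr_ge0// dist1_ge0.
have main rho : 0 < rho -> rho <= 1 ->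
    \sum_i cost (p i).1 (p i).2 <= \sum_i cost (p (s i)).1 (p i).2 + rho * \sum_i K i.
  move=> rho0 rho1; pose Q i := window rho (p i).
  have mQ i : measurable (Q i) by exact: measurable_window.
  have Q0 i : (0 < gamma (Q i))%E by exact: p0.
  have [tau [tau0 [gamma' [m1 m2 gI]]]] := swap_coupling s_inj mQ Q0.
  have gg' : (transport_cost gamma <= transport_cost gamma')%E.
    by apply: gopt; split => A mA; rewrite /pushforward ?m1 ?m2//; [exact: g1|exact: g2].
  have mc := @measurable_cost _ _ (@fst (Rd R d) (Rd R d)) (@snd (Rd R d) (Rd R d))
    measurable_fst measurable_snd.
  have := gI _ mc (fun z => cost_ge0 z.1 z.2).
  rewrite -/(transport_cost gamma) -/(transport_cost gamma').
  have Ifin : transport_cost gamma \is a fin_num.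
    by rewrite ge0_fin_numE//; apply: integral_ge0 => z _; rewrite lee_fin cost_ge0.
  set ST := (X in (_ + X)%E) => IST.
  set SQ := (X in (_ = _ + X)%E) in IST.
  have : (ST <= SQ)%E.
    by rewrite -(leeD2lE _ _ Ifin) -IST leeD2r.
  have gE i : gamma (Q i) = (fine (gamma (Q i)))%:E by rewrite fineK// fin_num_measure.
  have g0 i : 0 < fine (gamma (Q i)) by rewrite -lte_fin -gE.
  pose lo i := Num.max 0 (cost (p i).1 (p i).2 - rho * (2 * (dist1 (p i).1 (p i).2 + d%:R))).
  pose hi i := cost (p (s i)).1 (p i).2 + rho * (2 * (dist1 (p (s i)).1 (p i).2 + d%:R)).
  have STlo : ((\sum_i tau * lo i)%:E <= ST)%E.
    rewrite -sumEFin; apply: lee_sum => i _.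
    have -> : (tau * lo i)%:E =
        ((tau / fine (gamma (Q i)))%:E * \int[gamma]_(z in Q i) (lo i)%:E)%E.
      rewrite integral_cst//= [X in (_ * (_ * X))%E](gE i) -!EFinM; congr EFin.
      by field; rewrite gt_eqF.
    rewrite lee_pmul2l// ?lte_fin ?divr_gt0//.
    apply: ge0_le_integral => //.
    - by move=> z _; rewrite lee_fin le_max lexx.
    - exact: measurable_funTS.
    - move=> z [z1 z2]; rewrite lee_fin ge_max cost_ge0/= lerBlDr.
      by have := cost_window rho1 z1 z2; rewrite ler_distl => /andP[]; clear; lra.
  have SQhi : (SQ <= (\sum_i tau * hi i)%:E)%E.
    rewrite -sumEFin; apply: lee_sum => i _.
    have -> : (tau * hi i)%:E =
        ((tau / (fine (gamma (Q (s i))) * fine (gamma (Q i))))%:E *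
         \int[gamma \x gamma]_(z in Q (s i) `*` Q i) (hi i)%:E)%E.
      rewrite integral_cst//=; last exact: measurableX.
      rewrite product_measure1E// [X in (_ * (_ * (X * _)))%E](gE (s i)).
      rewrite [X in (_ * (_ * (_ * X)))%E](gE i).
      by rewrite -!EFinM; congr EFin; field; rewrite !gt_eqF.
    rewrite lee_pmul2l// ?lte_fin ?divr_gt0 ?mulr_gt0//.
    apply: ge0_le_integral => //.
    - exact: measurableX.
    - by move=> z _; rewrite lee_fin cost_ge0.
    - apply: measurable_funTS.
      apply: (measurable_cost (f := fst \o fst) (g := snd \o snd)).
        exact: (measurableT_comp measurable_fst measurable_fst).
      exact: (measurableT_comp measurable_snd measurable_snd).
    - move=> z [[z1 _] [_ z2]]; rewrite lee_fin.
      by have := cost_window rho1 z1 z2; rewrite ler_distl => /andP[]; rewrite /hi; clear; lra.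
  move=> STSQ; have lohi : \sum_i lo i <= \sum_i hi i.
    have := le_trans STlo (le_trans STSQ SQhi).
    by rewrite lee_fin -!mulr_sumr ler_pM2l.
  have hiE : \sum_i hi i = \sum_i cost (p (s i)).1 (p i).2 +
      rho * \sum_i 2 * (dist1 (p (s i)).1 (p i).2 + d%:R).
    by rewrite mulr_sumr -big_split.
  have : \sum_i cost (p i).1 (p i).2 -
      rho * \sum_i 2 * (dist1 (p i).1 (p i).2 + d%:R) <= \sum_i lo i.
    rewrite mulr_sumr -sumrB; apply: ler_sum => i _.
    by rewrite /lo le_max lexx orbT.
  by rewrite /K big_split/= mulrDr; move: lohi; rewrite hiE; clear; lra.
have cle : \sum_i cost (p i).1 (p i).2 <= \sum_i cost (p (s i)).1 (p i).2.
  apply/ler_addgt0Pr => e e0; set S := \sum_i K i in main.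
  have S0 : 0 <= S by exact: sumr_ge0.
  have [rho [rho0 rho1 rhoS]] : exists rho, [/\ 0 < rho, rho <= 1 & rho * S <= e].
    exists (Num.min 1 (e / (S + 1))); split.
    - by rewrite lt_min ltr01 divr_gt0// ltr_wpDl.
    - by rewrite ge_min lexx.
    - apply: (@le_trans _ _ (e / (S + 1) * S)).
        by rewrite ler_wpM2r// ge_min lexx orbT.
      by rewrite mulrAC ler_pdivrMr ?ltr_wpDl// ler_pM2l// lerDl.
  by apply: le_trans (main rho rho0 rho1) _; rewrite lerD2l.
move: cle; under eq_bigr do rewrite cost_dot.
under [X in _ <= X -> _]eq_bigr do rewrite cost_dot.
rewrite !sumrB !big_split/= [X in X + _ - _](reindex_inj s_inj)/=; lra.
Qed.

End cyclic_monotonicity.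

(** * Kantorovich potentials *)

Section support.
Context {R : realType} {d : nat}.
Variable gamma : probability (Rd R d * Rd R d)%type R.

Definition plan_support : set (Rd R d * Rd R d) :=
  [set z | forall rho, 0 < rho -> (0 < gamma (window rho z))%E].

(** Points off the support lie in one of the countably many null windows that have
    a rational centre and size 1 / (k + 1). *)
Lemma ae_plan_support : {ae gamma, forall z, plan_support z}.
Proof.
pose box (qk : (d.-tuple rat * d.-tuple rat) * nat) :=
  window (qk.2.+1%:R^-1) (rational_point qk.1.1 : Rd R d, rational_point qk.1.2 : Rd R d).
pose F n := if unpickle n is Some qk then
  (if gamma (box qk) == 0%E then box qk else set0) else set0.
have F_null : gamma.-negligible (\bigcup_n F n).
  apply: negligible_bigcup => n; rewrite /F; case: unpickle => [qk|]; last exact: negligible_set0.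
  case: eqP => [g0|_]; last exact: negligible_set0.
  by apply/negligibleP => //; exact: measurable_window.
apply: negligibleS F_null => z /= /existsNP[rho /not_implyP[rho0 /negP]].
rewrite lt_neqAle measure_ge0 andbT negbK => /eqP g0.
pose k := Num.truncn (2 / rho).
have krho : 2 * k.+1%:R^-1 <= rho.
  by rewrite ler_pdivrMr// mulrC -ler_pdivrMr// ltW// truncnS_gt.
have k0 : 0 < k.+1%:R^-1 :> R by rewrite invr_gt0.
have [q1 q1z] := rational_point_dense z.1 k0.
have [q2 q2z] := rational_point_dense z.2 k0.
exists (pickle ((q1, q2), k)) => //; rewrite /F pickleK.
case: eqP => [_|]; first by split.
case; apply/eqP; rewrite eq_le measure_ge0 andbT g0.
apply: le_measure; rewrite ?inE; [exact: measurable_window|exact: measurable_window|].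
move=> w [w1 w2]; split => i /=.
  have := w1 i; have := q1z i; rewrite /= distrC => h1 h2.
  have := ler_normD (tnth w.1 i - tnth (rational_point q1) i)
    (tnth (rational_point q1) i - tnth z.1 i).
  rewrite addrA subrK => /le_lt_trans; apply; apply: lt_le_trans krho.
  by rewrite mulr_natl mulr2n ltrD.
have := w2 i; have := q2z i; rewrite /= distrC => h1 h2.
have := ler_normD (tnth w.2 i - tnth (rational_point q2) i)
  (tnth (rational_point q2) i - tnth z.2 i).
rewrite addrA subrK => /le_lt_trans; apply; apply: lt_le_trans krho.
by rewrite mulr_natl mulr2n ltrD.
Qed.

End support.

Section sup_lipschitz.
Context {R : realType} {d : nat} (I : Type) (D : set I) (F : I -> Rd R d -> R) (L : R).
Hypothesis D0 : D !=set0.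
Hypothesis F_ub : forall x, has_ubound [set F i x | i in D].
Hypothesis F_lip : forall i, D i -> forall x y, F i x - F i y <= L * dist1 x y.

Lemma le_sup_family i x : D i -> F i x <= sup [set F i x | i in D].
Proof. by move=> Di; apply: ub_le_sup; [exact: F_ub|exists i]. Qed.

Lemma sup_family_le x K : (forall i, D i -> F i x <= K) -> sup [set F i x | i in D] <= K.
Proof.
move=> FK; apply: ge_sup => [|_ [i Di <-]]; last exact: FK.
by have [i Di] := D0; exists (F i x); exists i.
Qed.

Lemma sup_lipschitz x y :
  `|sup [set F i x | i in D] - sup [set F i y | i in D]| <= L * dist1 x y.
Proof.
have main a b : sup [set F i a | i in D] - sup [set F i b | i in D] <= L * dist1 a b.
  rewrite lerBlDr; apply: sup_family_le => i Di.
  rewrite -lerBlDr; apply: le_trans (F_lip Di a b); rewrite lerD2l lerN2.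
  exact: le_sup_family.
by rewrite ler_norml main andbT lerNl opprB dist1C main.
Qed.

End sup_lipschitz.

Section potentials.
Context {R : realType} {d : nat}.
Implicit Types (x y : Rd R d) (p z : Rd R d * Rd R d) (G : set (Rd R d * Rd R d)).

(** The affine minorants in Rockafellar's formula.  The path from z0 is stored
    backwards: the head of s is the point visited last, whose second component is
    the slope. *)
Fixpoint chain z0 x (s : seq (Rd R d * Rd R d)) : R :=
  match s with
  | [::] => dot x z0.2 - dot z0.1 z0.2
  | p :: s' => dot x p.2 - dot p.1 p.2 + chain z0 p.1 s'
  end.

Lemma chain_sub z0 x x' s :
  chain z0 x s - chain z0 x' s = dot x (head z0 s).2 - dot x' (head z0 s).2.
Proof. by case: s => [|p s] /=; ring. Qed.

(** At x = z0.1 the arguments on the left are the first components of L, shifted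
    cyclically by one: this is what cyclic monotonicity bounds. *)
Lemma chainE z0 x s : let L := rcons s z0 in
  chain z0 x s = \sum_(i < (size s).+1)
    (dot (nth z0.1 (x :: map fst L) i) (nth z0 L i).2 - dot (nth z0 L i).1 (nth z0 L i).2).
Proof.
elim: s x => [|p s IHs] x /=; first by rewrite big_ord_recl big_ord0 addr0.
by rewrite big_ord_recl/= IHs.
Qed.

Lemma chain_le0 mu nu (gamma : probability (Rd R d * Rd R d)%type R) z0 s :
  optimal_coupling mu nu gamma -> (transport_cost gamma < +oo)%E ->
  plan_support gamma z0 -> (forall p, p \in s -> plan_support gamma p) ->
  chain z0 z0.1 s <= 0.
Proof.
move=> gopt goo z0s ss; pose L := rcons s z0.
pose p (i : 'I_(size s).+1) := nth z0 L i.
have ps i rho : 0 < rho -> (0 < gamma (window rho (p i)))%E.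
  have : p i \in L by rewrite mem_nth// size_rcons.
  by rewrite mem_rcons inE => /predU1P[->|/ss]; [exact: z0s|exact].
have prev_inj : injective (@ord_pred (size s).+1) by exact: ord_pred_inj.
have := optimal_cyclically_monotone gopt goo prev_inj ps.
rewrite chainE sumrB subr_le0; apply: le_trans; rewrite le_eqVlt; apply/orP; left.
apply/eqP; apply: eq_bigr => -[[|i] ilt] _ /=; congr dot.
  by rewrite /p/= modn_small// ?addnS//= nth_rcons ltnn eqxx.
rewrite (nth_map z0) ?size_rcons; last exact: ltnW.
by rewrite /p/= modnDr modn_small// ltnW.
Qed.

Lemma transport_cost_fin (gamma : probability (Rd R d * Rd R d)%type R) (r : R) :
  {ae gamma, forall z, cube r z.1 /\ cube r z.2} -> (transport_cost gamma < +oo)%E.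
Proof.
move=> gr; apply: integrable_lty => //.
have mc : measurable_fun setT (fun z : Rd R d * Rd R d => 2^-1 * euclid_dist z.1 z.2 ^+ 2).
  by apply: measurable_funM => //; exact: measurable_euclid_dist_sqr.
apply: (integrableR_bounded (K := r * (d%:R * (2 * r))) mc).
apply: filterS gr => z [z1 z2].
rewrite ger0_norm; last by rewrite mulr_ge0// sqr_ge0.
rewrite ler_pdivrMl// [leRHS]mulrA.
apply: le_trans (euclid_dist_sqr_cube z1 z2) _.
have [r0|r0] := leP 0 r; first by apply: ler_wpM2l; [exact: mulr_ge0|exact: cube_dist1].
have -> : dist1 z.1 z.2 = 0.
  apply: big1 => i _; have := le_lt_trans (normr_ge0 _) (z1 i).
  by rewrite ltNge (ltW r0).
have -> : d%:R = \sum_(i < d) (1 : R) by rewrite sumr_const card_ord.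
rewrite big1 ?mulr0 ?mul0r ?mulr0// => i _; have := le_lt_trans (normr_ge0 _) (z1 i).
by rewrite ltNge (ltW r0).
Qed.

(** The function phi is the supremum of all chains in the support, hence convex,
    and Lipschitz because the slopes are second components of points of the
    support.  Of its convexity only second differences along the axes will be
    used.  The function psi is a conjugate of phi, with a supremum restricted to
    the cube: over the whole space it could be infinite. *)
Lemma kantorovich_potentials (mu nu : probability (Rd R d) R)
    (gamma : probability (Rd R d * Rd R d)%type R) (r1 r2 : R) :
  0 < r1 -> 0 <= r2 -> optimal_coupling mu nu gamma ->
  {ae gamma, forall z, cube r1 z.1 /\ cube r2 z.2} ->
  exists phi psi : Rd R d -> R, [/\
    forall x x', `|phi x - phi x'| <= r2 * dist1 x x',
    forall y y', `|psi y - psi y'| <= r1 * dist1 y y',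
    forall (i : 'I_d) (e : R) x,
      2 * phi x <= phi (coord_shift i e x) + phi (coord_shift i (- e) x),
    forall x y, cube r1 x -> dot x y <= phi x + psi y &
    {ae gamma, forall z, phi z.1 + psi z.2 = dot z.1 z.2}].
Proof.
move=> r10 r20 gopt gr.
have goo : (transport_cost gamma < +oo)%E.
  apply: (@transport_cost_fin _ (Num.max r1 r2)); apply: filterS gr => z [z1 z2].
  by split; [apply: cubeS z1|apply: cubeS z2]; rewrite le_max lexx ?orbT.
pose G : set (Rd R d * Rd R d) :=
  [set z | [/\ cube r1 z.1, cube r2 z.2 & plan_support gamma z]].
have aeG : {ae gamma, forall z, G z}.
  by apply: filterS2 gr (ae_plan_support gamma) => z [z1 z2] zs; split.
have [z0 Gz0] : exists z0, G z0.
  apply: contrapT => nG; have [N [mN N0 sub]] := aeG.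
  have : gamma setT = 0%E.
    apply/eqP; rewrite eq_le measure_ge0 andbT -N0; apply: le_measure; rewrite ?inE//.
    by move=> z _; apply: sub => /= Gz; apply: nG; exists z.
  by move/eqP; rewrite probability_setT onee_eq0.
pose S : set (seq (Rd R d * Rd R d)) :=
  [set s : seq (Rd R d * Rd R d) | forall p, p \in s -> G p].
pose C s x := chain z0 x s.
have S0 : S !=set0 by exists [::].
have head_r2 s : S s -> forall i, `|tnth (head z0 s).2 i| <= r2.
  by case: s => [|p s] Ss i /=; [have [_ + _] := Gz0|have [_ + _] := Ss p (mem_head _ _)];
    move=> /(_ i)/ltW.
have C_lip s : S s -> forall x y, C s x - C s y <= r2 * dist1 x y.
  move=> Ss x y; rewrite chain_sub; apply: le_trans (ler_norm _) _.
  exact: dot_lipschitz r20 (head_r2 s Ss).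
have C_ub x : has_ubound [set C s x | s in S].
  exists (r2 * dist1 x z0.1) => _ [s Ss <-].
  have := C_lip s Ss x z0.1.
  have : C s z0.1 <= 0.
    have [_ _ z0s] := Gz0.
    by apply: chain_le0 gopt goo z0s _ => p /Ss[].
  by lra.
pose phi x := sup [set C s x | s in S].
have phi_lip x x' : `|phi x - phi x'| <= r2 * dist1 x x' by exact: sup_lipschitz.
have sub p x : G p -> phi p.1 + dot x p.2 - dot p.1 p.2 <= phi x.
  move=> Gp; rewrite -addrA -lerBrDr; apply: sup_family_le => // s Ss.
  have Sps : S (p :: s) by move=> q; rewrite inE => /predU1P[->//|/Ss].
  have := le_sup_family C_ub x Sps; rewrite -/(phi x) /C /=; lra.
pose D (x y : Rd R d) := dot x y - phi x.
have cube0 : @cube R d r1 !=set0.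
  by exists (euclid_origin d) => i; rewrite tnth_mktuple normr0.
have D_lip x : cube r1 x -> forall y y', D x y - D x y' <= r1 * dist1 y y'.
  move=> xr y y'; rewrite /D opprB addrA subrK dotC [dot x y']dotC.
  apply: le_trans (ler_norm _) (dot_lipschitz _ _ (ltW r10) _) => i.
  exact: ltW.
have D_ub y : has_ubound [set D x y | x in cube r1].
  have [x0 x0r] := cube0.
  exists (r1 * dist1 y (euclid_origin d) + (r2 * (d%:R * (2 * r1)) - phi x0)) => _ [x xr <-].
  have := D_lip x xr y (euclid_origin d).
  have -> : D x (euclid_origin d) = - phi x.
    by rewrite /D /dot big1 ?sub0r// => i _; rewrite tnth_mktuple mulr0.
  have := phi_lip x0 x; rewrite ler_norml => /andP[_].
  have : r2 * dist1 x0 x <= r2 * (d%:R * (2 * r1)) by rewrite ler_wpM2l// cube_dist1.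
  by lra.
pose psi y := sup [set D x y | x in cube r1].
exists phi, psi; split => //.
- by move=> y y'; exact: sup_lipschitz.
- move=> i e x; rewrite mulrC -ler_pdivlMr//; apply: sup_family_le => // s Ss.
  rewrite ler_pdivlMr//.
  have h1 := le_sup_family C_ub (coord_shift i e x) Ss.
  have h2 := le_sup_family C_ub (coord_shift i (- e) x) Ss.
  apply: le_trans (lerD h1 h2).
  have := chain_sub z0 (coord_shift i e x) x s.
  have := chain_sub z0 (coord_shift i (- e) x) x s.
  by rewrite !dot_shift /C; lra.
- move=> x y xr; have := le_sup_family D_ub y xr; rewrite -/(psi y) /D; lra.
- apply: filterS aeG => z Gz; have [z1 z2 zs] := Gz.
  apply/eqP; rewrite eq_le; apply/andP; split.
    rewrite addrC -lerBrDr; apply: sup_family_le => // x xr.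
    by have := sub z x Gz; rewrite /D; lra.
  have := le_sup_family D_ub z.2 z1; rewrite -/(psi z.2) /D; lra.
Qed.

End potentials.

(** * Second differences against the Lebesgue measure *)

Section lebesgue_Rd_translation.
Context {R : realType} {d : nat}.

Lemma lebesgue_measure_translation (e : R) (A : set (measurableTypeR R)) : measurable A ->
  lebesgue_measure ((fun x => x + e) @^-1` A : set (measurableTypeR R)) = lebesgue_measure A.
Proof.
have me : measurable_fun setT ((fun x => x + e) : measurableTypeR R -> measurableTypeR R).
  exact: measurable_funD.
have [M ME] := measure_pushforward (@lebesgue_measure R) me.
move=> mA; transitivity (M A); first by rewrite ME.
apply/esym/lebesgue_measure_unique => //= _ [[a b]] _ <-.
rewrite ME /pushforward [X in _ = lebesgue_measure X](_ : _ = `]a - e, b - e]%classic); last first.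
  by apply/seteqP; split => x /=; rewrite !in_itv/= ltrBlDr lerBrDr.
by rewrite !lebesgue_measure_itv/= !lte_fin ltrD2r -!EFinB; case: ifP => // _; congr EFin; ring.
Qed.

Definition boxes : set (set (Rd R d)) :=
  [set E | exists A : 'I_d -> set (measurableTypeR R), (forall i, measurable (A i)) /\
    E = [set x | forall i, A i (tnth x i)]].

Lemma measurable_boxes : measurable = <<s boxes >>.
Proof.
apply/seteqP; split => [A mA|]; last first.
  apply: smallest_sub; first exact: sigma_algebra_measurable.
  by move=> _ [B [mB ->]]; exact: measurable_box.
have : @measurable_fun _ _ (g_sigma_algebraType boxes) (Rd R d) setT id.
  apply/measurable_fun_tnthP => i _ B mB; rewrite setTI.
  apply: sub_sigma_algebra; exists (fun j => if j == i then B else setT); split.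
    by move=> j; case: ifP.
  apply/seteqP; split => [x /= Bx j|x /= /(_ i)]; last by rewrite eqxx.
  by case: eqP => // ->.
by move=> /(_ measurableT A mA); rewrite setTI.
Qed.

Lemma cube_box (r : R) :
  cube r = [set x : Rd R d | forall i, `]-r, r[%classic (tnth x i)].
Proof. by apply/seteqP; split => x xr i; have := xr i; rewrite /= in_itv/= ltr_norml. Qed.

Lemma lebesgue_Rd_box_itv (a b : 'I_d -> R) (ba bb : bool) : (forall i, a i <= b i) ->
  lebesgue_Rd R d
    [set x | forall i, [set` Interval (BSide ba (a i)) (BSide bb (b i))] (tnth x i)] =
  (\prod_i (b i - a i))%:E.
Proof.
move=> ab; rewrite (lebesgue_Rd_box
    (A := fun i => [set` Interval (BSide ba (a i)) (BSide bb (b i))])) => [|i]; last first.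
  exact: measurable_itv.
rewrite (big_morph EFin (@EFinM R) erefl); apply: eq_bigr => i _.
rewrite lebesgue_measure_itv/= lte_fin; case: ltP => [_|ba']; first by rewrite EFinB.
by have -> : a i = b i; [apply/eqP; rewrite eq_le ab|rewrite subrr].
Qed.

Lemma lebesgue_Rd_cube (r : R) : 0 <= r -> lebesgue_Rd R d (cube r) = ((2 * r) ^+ d)%:E.
Proof.
move=> r0; rewrite cube_box (@lebesgue_Rd_box_itv (fun=> - r) (fun=> r) false true) => [|_].
  by rewrite prodr_const card_ord; congr (_ ^+ _)%:E; ring.
by rewrite lerNl (le_trans _ r0)// oppr_le0.
Qed.

(** Two sigma-finite measures that agree on boxes are equal, and on boxes the claim
    reduces to dimension one. *)
Lemma lebesgue_Rd_translation (i : 'I_d) (e : R) (A : set (Rd R d)) : measurable A ->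
  lebesgue_Rd R d (coord_shift i e @^-1` A) = lebesgue_Rd R d A.
Proof.
have [M ME] := measure_pushforward (lebesgue_Rd R d) (@measurable_shift R d i e).
move=> mA; transitivity (M A); first by rewrite ME.
apply/esym; move: A mA; apply: (measure_unique boxes (fun k => cube k%:R)).
- exact: measurable_boxes.
- move=> _ _ [A [mA ->]] [B [mB ->]]; exists (fun i => A i `&` B i); split.
    by move=> j; exact: measurableI.
  by apply/seteqP; split => [x [Ax Bx] j|x ABx]; [split|split => j; have [] := ABx j].
- move=> k; rewrite cube_box; exists (fun=> `]- k%:R, k%:R[%classic); split => //.
- apply/seteqP; split => // x _; exists (Num.truncn (\sum_i `|tnth x i|)).+1 => // j.
  apply: le_lt_trans (truncnS_gt _); rewrite (bigD1 j)//= lerDl; exact: sumr_ge0.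
- move=> _ [A [mA ->]]; rewrite ME /pushforward [LHS](lebesgue_Rd_box mA).
  pose B j := (fun t => t + (j == i)%:R * e) @^-1` A j : set (measurableTypeR R).
  rewrite [X in _ = lebesgue_Rd R d X](_ : _ = [set x | forall j, B j (tnth x j)]); last first.
    by apply/seteqP; split => x /= Ax j; have := Ax j; rewrite /B /= tnth_mktuple.
  rewrite (lebesgue_Rd_box (A := B)) => [|j].
    by apply: eq_bigr => j _; rewrite /B lebesgue_measure_translation.
  rewrite /B -[X in measurable X]setTI.
  have me : measurable_fun setT
      ((fun t => t + (j == i)%:R * e) : measurableTypeR R -> measurableTypeR R).
    exact: measurable_funD.
  exact: me.
- by move=> k; rewrite [X in (X < _)%E](lebesgue_Rd_cube (ler0n R k)) ltry.
Qed.

End lebesgue_Rd_translation.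

Section second_difference.
Context {R : realType} {d : nat}.

Lemma coord_shiftK (i : 'I_d) (e : R) (x : Rd R d) : coord_shift i e (coord_shift i (- e) x) = x.
Proof. by apply: eq_from_tnth => j; rewrite !tnth_mktuple mulrN subrK. Qed.

(** With h the first difference of phi in the direction i, the integrand is
    h x - h (x - e e_i).  By translation invariance its integral reduces to the
    integral of h over a slab of width e, and h is O(e) there. *)
Lemma integral_second_difference (phi : Rd R d -> R) (L e r : R) (i : 'I_d) :
  0 <= L -> 0 < e -> 0 < r ->
  (forall x x', `|phi x - phi x'| <= L * dist1 x x') ->
  (forall x, 2 * phi x <= phi (coord_shift i e x) + phi (coord_shift i (- e) x)) ->
  (\int[lebesgue_Rd R d]_(x in cube r)
     (phi (coord_shift i e x) + phi (coord_shift i (- e) x) - 2 * phi x)%:E <=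
   (2 * L * (2 * r) ^+ d.-1 * e ^+ 2)%:E)%E.
Proof.
move=> L0 e0 r0 phiL phi_conv; set la := lebesgue_Rd R d; set Q := cube r.
have mphi : measurable_fun setT phi by exact: measurable_lipschitz L0 phiL.
have mphis a : measurable_fun setT (fun x => phi (coord_shift i a x)).
  exact: measurableT_comp mphi (measurable_shift i a).
(* The constant L * e makes h nonnegative. *)
pose h x := phi (coord_shift i e x) - phi x + L * e.
pose D x := phi (coord_shift i e x) + phi (coord_shift i (- e) x) - 2 * phi x.
have mh : measurable_fun setT h.
  by apply: measurable_funD => //; exact: measurable_funB.
have mD : measurable_fun setT D.
  by apply: measurable_funB; [exact: measurable_funD|exact: measurable_funM].
have h0 x : 0 <= h x /\ h x <= 2 * (L * e).
  have := phiL (coord_shift i e x) x; rewrite dist1_shift (gtr0_norm e0) ler_norml /h.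
  by move=> /andP[]; split; lra.
have D0 x : 0 <= D x by rewrite subr_ge0.
have hD x : D x + h (coord_shift i (- e) x) = h x.
  by rewrite /D /h coord_shiftK; ring.
have mQ : measurable Q by exact: measurable_cube.
(* The points that stay in the cube when translated by e. *)
pose B := Q `&` [set x | tnth x i < r - e].
have mB : measurable B.
  apply: measurableI => //.
  pose A j := if j == i then `]-oo, r - e[%classic else setT.
  rewrite (_ : [set x | _] = [set x : Rd R d | forall j, A j (tnth x j)]).
    by apply: (measurable_box (A := A)) => j; rewrite /A; case: ifP.
  apply/seteqP; split => [x /= xi j|x /= /(_ i)]; last by rewrite /A eqxx/= in_itv.
  by rewrite /A; case: eqP => [->|//]; rewrite /= in_itv.
have mtB : measurable (coord_shift i (- e) @^-1` B).
  by rewrite -[X in measurable X]setTI; exact: measurable_shift.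
have tBQ : coord_shift i (- e) @^-1` B `<=` Q.
  move=> x [xQ /=]; rewrite tnth_mktuple eqxx mul1r => xi j; have := xQ j.
  rewrite tnth_mktuple; case: eqP => [->|_]; last by rewrite mul0r addr0.
  by rewrite mul1r !ltr_norml => /andP[]; lra.
have intB : (\int[la]_(x in coord_shift i (- e) @^-1` B) (h (coord_shift i (- e) x))%:E =
    \int[la]_(x in B) (h x)%:E)%E.
  rewrite -(@ge0_integral_pushforward _ _ _ _ _ _ (measurable_shift i (- e)) la B
    (fun x => (h x)%:E))//.
  - apply: eq_measure_integral => [|mt A mA _]; first exact: measurable_shift.
    exact: (lebesgue_Rd_translation i (- e) mA).
  - by apply: measurable_funTS; exact/measurable_EFinP.
  - by move=> y _; rewrite lee_fin; have [] := h0 y.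
have Qslab : (la (Q `\` B) <= (e * (2 * r) ^+ d.-1)%:E)%E.
  pose a j : R := if j == i then r - e else - r.
  have ar j : a j <= r by rewrite /a; case: ifP => _; lra.
  apply: (@le_trans _ _ (la [set x : Rd R d | forall j, `[a j, r]%classic (tnth x j)])).
    apply: le_measure; rewrite ?inE; first exact: measurableD.
      by apply: (measurable_box (A := fun j => `[a j, r]%classic)) => j; exact: measurable_itv.
    move=> x [xQ xB] j; have := xQ j; rewrite ltr_norml => /andP[xj1 xj2].
    rewrite /= in_itv/= (ltW xj2) andbT /a; case: eqP => [->|_]; last exact: ltW.
    by rewrite leNgt; apply/negP => xi; apply: xB.
  rewrite [leLHS](@lebesgue_Rd_box_itv _ _ a (fun=> r) true false ar) lee_fin (bigD1 i)//=.
  rewrite {1}/a eqxx opprB addrC subrK ler_pM2l//.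
  rewrite (eq_bigr (fun=> 2 * r)) => [|j ji]; last by rewrite /a (negbTE ji); ring.
  by rewrite prodr_const cardC1 card_ord.
have QB : Q = B `|` (Q `\` B) by rewrite setDE setUIr setUv setIT; apply/esym/setUidr => x [].
have mEh (S : set (Rd R d)) : measurable_fun S (fun x => (h x)%:E).
  by apply: measurable_funTS; exact/measurable_EFinP.
have intQ : (\int[la]_(x in Q) (h x)%:E <=
    \int[la]_(x in B) (h x)%:E + (2 * (L * e) * (e * (2 * r) ^+ d.-1))%:E)%E.
  rewrite {1}QB ge0_integral_setU//; last first.
  - by rewrite disj_set2E setDE setICA setICr setI0.
  - by move=> x _; rewrite lee_fin; have [] := h0 x.
  - exact: measurableD.
  rewrite leeD2l//; apply: (@le_trans _ _ (\int[la]_(x in Q `\` B) (2 * (L * e))%:E)%E).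
    apply: ge0_le_integral => //.
    - exact: measurableD.
    - by move=> x _; rewrite lee_fin; have [] := h0 x.
    - by move=> x _; rewrite lee_fin; have [] := h0 x.
  rewrite integral_cst//; last exact: measurableD.
  by rewrite [X in (_ <= X)%E]EFinM lee_wpmul2l// lee_fin !mulr_ge0// ltW.
have Bfin : (\int[la]_(x in B) (h x)%:E)%E \is a fin_num.
  rewrite ge0_fin_numE; last by apply: integral_ge0 => x _; rewrite lee_fin; have [] := h0 x.
  apply: (@le_lt_trans _ _ (\int[la]_(x in B) (2 * (L * e))%:E)%E).
    apply: ge0_le_integral => //.
    - by move=> x _; rewrite lee_fin; have [] := h0 x.
    - by move=> x _; rewrite lee_fin; have [] := h0 x.
  rewrite integral_cst//; apply: (@le_lt_trans _ _ ((2 * (L * e))%:E * la Q)%E).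
    rewrite lee_wpmul2l ?lee_fin ?mulr_ge0 ?(ltW e0)//.
    by apply: le_measure; rewrite ?inE// => x [].
  by rewrite [la Q](lebesgue_Rd_cube (ltW r0)) -EFinM ltry.
rewrite -(leeD2lE _ _ Bfin); apply: (@le_trans _ _ (\int[la]_(x in Q) (h x)%:E)%E); last first.
  by apply: le_trans intQ _; rewrite leeD2l// lee_fin le_eqVlt; apply/orP; left; apply/eqP; ring.
have -> : (\int[la]_(x in Q) (h x)%:E = \int[la]_(x in Q) (D x)%:E +
    \int[la]_(x in Q) (h (coord_shift i (- e) x))%:E)%E.
  rewrite -ge0_integralD//.
  - by apply: eq_integral => x _; rewrite -EFinD hD.
  - by move=> x _; rewrite lee_fin.
  - by apply: measurable_funTS; exact/measurable_EFinP.
  - by move=> x _; rewrite lee_fin; have [] := h0 (coord_shift i (- e) x).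
  - apply: measurable_funTS; apply/measurable_EFinP.
    exact: measurableT_comp mh (measurable_shift i (- e)).
rewrite [X in (X <= _)%E]addeC; apply: leeD; first by [].
rewrite -intB; apply: ge0_subset_integral => //.
- apply: measurable_funTS; apply/measurable_EFinP.
  exact: measurableT_comp mh (measurable_shift i (- e)).
- by move=> x _; rewrite lee_fin; have [] := h0 (coord_shift i (- e) x).
Qed.

End second_difference.

(** * From the potentials to the second coordinates *)

Section estimates.
Context {R : realType} {d : nat}.
Implicit Types (mu nu : probability (Rd R d) R)
  (gamma : probability (Rd R d * Rd R d)%type R).

Lemma supported_on_cube mu r : supported_on mu (@euclid_ball R d r) ->
  {ae mu, forall x, cube r x}.
Proof.
move=> mur; have := ae_of_probability0 (measurable_euclid_ball r) mur.
by apply: filterS => x; exact: euclid_ball_cube.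
Qed.

Lemma coupling_cube mu nu gamma r1 r2 : coupling mu nu gamma ->
  {ae mu, forall x, cube r1 x} -> {ae nu, forall x, cube r2 x} ->
  {ae gamma, forall z, cube r1 z.1 /\ cube r2 z.2}.
Proof.
move=> [g1 g2] mur nur.
have h1 := ae_image measurable_fst g1 mur.
have h2 := ae_image measurable_snd g2 nur.
by apply: filterS2 h1 h2.
Qed.

Lemma integrableR_lipschitz mu r L f : 0 < r -> 0 <= L ->
  {ae mu, forall x, cube r x} -> (forall x y, `|f x - f y| <= L * dist1 x y) ->
  integrableR mu f.
Proof.
move=> r0 L0 mur fL; pose o := euclid_origin d : Rd R d.
have or : cube r o by move=> i; rewrite tnth_mktuple normr0.
apply: (@integrableR_bounded _ _ _ _ (`|f o| + L * (d%:R * (2 * r)))).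
  exact: measurable_lipschitz L0 fL.
apply: filterS mur => x xr; rewrite addrC -lerBlDr.
apply: (le_trans (lerB_dist _ _)); apply: le_trans (fL x o) _.
by rewrite ler_wpM2l//; exact: cube_dist1.
Qed.

Lemma integrableR_dist1 d' (T : measurableType d') (P : probability T R)
    (f g : T -> Rd R d) r :
  measurable_fun setT f -> measurable_fun setT g ->
  {ae P, forall x, cube r (f x) /\ cube r (g x)} ->
  integrableR P (fun x => dist1 (f x) (g x)).
Proof.
move=> mf mg fg; apply: (@integrableR_bounded _ _ _ _ (d%:R * (2 * r))).
  exact: measurable_dist1.
apply: filterS fg => x [fx gx]; rewrite ger0_norm ?dist1_ge0//; exact: cube_dist1.
Qed.

Lemma integrableR_coord d' (T : measurableType d') (P : probability T R)
    (f : T -> Rd R d) r i :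
  measurable_fun setT f -> {ae P, forall x, cube r (f x)} ->
  integrableR P (fun x => tnth (f x) i).
Proof.
move=> mf fr; apply: (@integrableR_bounded _ _ _ _ r); first exact: measurable_coord.
by apply: filterS fr => x /(_ i)/ltW.
Qed.

Lemma integrableR_dot d' (T : measurableType d') (P : probability T R)
    (f g : T -> Rd R d) r1 r2 :
  0 <= r1 -> 0 <= r2 ->
  measurable_fun setT f -> measurable_fun setT g ->
  {ae P, forall x, cube r1 (f x) /\ cube r2 (g x)} ->
  integrableR P (fun x => dot (f x) (g x)).
Proof.
move=> r10 r20 mf mg fg; apply: (@integrableR_bounded _ _ _ _ (d%:R * (r1 * r2))).
  exact: measurable_dot.
apply: filterS fg => x [fx gx]; apply: (le_trans (ler_norm_sum _ _ _)).
apply: (@le_trans _ _ (\sum_(i < d) r1 * r2)).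
  by apply: ler_sum => i _; rewrite normrM ler_pM// ltW.
by rewrite sumr_const card_ord mulr_natl.
Qed.

(** The Cauchy-Schwarz inequality, from the pointwise bound 2 b <= b ^ 2 / s + s. *)
Lemma mean_dist1 (sigma : probability (Rd R d * Rd R d)%type R) r s : 0 <= r -> 0 < s ->
  {ae sigma, forall z, cube r z.1 /\ cube r z.2} ->
  (\int[sigma]_z (euclid_dist z.1 z.2 ^+ 2)%:E <= (s ^+ 2)%:E)%E ->
  \int[sigma]_z dist1 z.1 z.2 <= d%:R * s.
Proof.
move=> r0 s0 sr sE.
have isq : integrableR sigma (fun z => euclid_dist z.1 z.2 ^+ 2).
  apply: (@integrableR_bounded _ _ _ _ (2 * r * (d%:R * (2 * r)))).
    exact: measurable_euclid_dist_sqr.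
  apply: filterS sr => z [z1 z2]; rewrite ger0_norm ?sqr_ge0//.
  apply: le_trans (euclid_dist_sqr_cube z1 z2) _.
  by apply: ler_wpM2l; [exact: mulr_ge0|exact: cube_dist1].
have sE' : \int[sigma]_z (euclid_dist z.1 z.2 ^+ 2) <= s ^+ 2.
  by rewrite -lee_fin EFin_Rintegral.
have pw (z : Rd R d * Rd R d) :
    dist1 z.1 z.2 <= d%:R * (2^-1 * (s^-1 * euclid_dist z.1 z.2 ^+ 2 + s)).
  apply: dist1_le => i; have := normB_le_euclid_dist z.1 z.2 i.
  set a := `|_|; set b := euclid_dist _ _ => ab; apply: (le_trans ab).
  rewrite ler_pdivlMl// -subr_ge0.
  have -> : s^-1 * b ^+ 2 + s - 2 * b = s^-1 * (b - s) ^+ 2 by field; rewrite gt_eqF.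
  by rewrite mulr_ge0 ?sqr_ge0// invr_ge0 ltW.
have ig := integrableRZ s^-1 isq; have ig2 := integrableRD ig (integrableR_cst sigma s).
have ig3 := integrableRZ 2^-1 ig2; have ig4 := integrableRZ d%:R ig3.
apply: (@le_trans _ _ (\int[sigma]_z (d%:R * (2^-1 * (s^-1 * euclid_dist z.1 z.2 ^+ 2 + s))))).
  apply: ae_le_Rintegral => //; last exact: aeW.
  by apply: integrableR_dist1 sr.
rewrite !RintegralZl// RintegralD// ?RintegralZl// ?Rintegral_prob_cst; last exact: integrableR_cst.
rewrite ler_wpM2l// ler_pdivrMl// [leRHS](_ : _ = s + s); last by ring.
by rewrite lerD2r ler_pdivrMl// -expr2.
Qed.

(** The easy half of Kantorovich-Rubinstein duality. *)
Lemma lipschitz_duality mu mu' sigma r L f : 0 < r -> 0 <= L ->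
  coupling mu mu' sigma ->
  {ae mu, forall x, cube r x} -> {ae mu', forall x, cube r x} ->
  (forall x y, `|f x - f y| <= L * dist1 x y) ->
  `|\int[mu]_x f x - \int[mu']_x f x| <= L * \int[sigma]_z dist1 z.1 z.2.
Proof.
move=> r0 L0 cs mur mur' fL; have sr := coupling_cube cs mur mur'.
have fi := integrableR_lipschitz r0 L0 mur fL.
have fi' := integrableR_lipschitz r0 L0 mur' fL.
have fi1 := integrableR_image measurable_fst cs.1 fi.
have fi2 := integrableR_image measurable_snd cs.2 fi'.
have di := integrableR_dist1 measurable_fst measurable_snd sr.
rewrite -(Rintegral_image measurable_fst cs.1 fi) -(Rintegral_image measurable_snd cs.2 fi').
rewrite -RintegralB// -RintegralZl//.
apply: (le_trans (le_normr_Rintegral _ _)) => //; first exact: integrableRB.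
apply: ae_le_Rintegral.
- exact: integrable_norm (integrableRB fi1 fi2).
- exact: integrableRZ.
- by apply: aeW => z; exact: fL.
Qed.

(** The mean under gamma of the gap of the potentials of gamma' is nonnegative.  In
    the sum of the two mean gaps the scalar products cancel, because each pair of
    potentials is tight for its own plan; lipschitz_duality bounds what is left. *)
Lemma duality_gap mu nu mu' nu' gamma gamma' sigma tau
    (r1 r2 : R) (phi psi phi' psi' : Rd R d -> R) :
  0 < r1 -> 0 < r2 ->
  coupling mu nu gamma -> coupling mu' nu' gamma' ->
  coupling mu mu' sigma -> coupling nu nu' tau ->
  {ae mu, forall x, cube r1 x} -> {ae nu, forall x, cube r2 x} ->
  {ae mu', forall x, cube r1 x} -> {ae nu', forall x, cube r2 x} ->
  (forall x y, `|phi x - phi y| <= r2 * dist1 x y) ->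
  (forall x y, `|phi' x - phi' y| <= r2 * dist1 x y) ->
  (forall x y, `|psi x - psi y| <= r1 * dist1 x y) ->
  (forall x y, `|psi' x - psi' y| <= r1 * dist1 x y) ->
  {ae gamma, forall z, phi z.1 + psi z.2 = dot z.1 z.2} ->
  {ae gamma', forall z, phi' z.1 + psi' z.2 = dot z.1 z.2} ->
  (forall x y, cube r1 x -> dot x y <= phi' x + psi' y) ->
  \int[gamma']_z (phi z.1 + psi z.2 - dot z.1 z.2) <=
    2 * r2 * \int[sigma]_z dist1 z.1 z.2 + 2 * r1 * \int[tau]_z dist1 z.1 z.2.
Proof.
move=> r10 r20 cg cg' cs ct mur nur mur' nur' phiL phiL' psiL psiL' eg eg' dual'.
have [r10' r20'] := (ltW r10, ltW r20).
have ip := integrableR_lipschitz r10 r20' mur phiL.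
have ip' := integrableR_lipschitz r10 r20' mur phiL'.
have jp := integrableR_lipschitz r10 r20' mur' phiL.
have jp' := integrableR_lipschitz r10 r20' mur' phiL'.
have iq := integrableR_lipschitz r20 r10' nur psiL.
have iq' := integrableR_lipschitz r20 r10' nur psiL'.
have jq := integrableR_lipschitz r20 r10' nur' psiL.
have jq' := integrableR_lipschitz r20 r10' nur' psiL'.
have gr := coupling_cube cg mur nur; have gr' := coupling_cube cg' mur' nur'.
have dg := integrableR_dot r10' r20' measurable_fst measurable_snd gr.
have dg' := integrableR_dot r10' r20' measurable_fst measurable_snd gr'.
have int2 m n (g : probability (Rd R d * Rd R d)%type R) f h : coupling m n g ->
    integrableR m f -> integrableR n h ->
    integrableR g (fun z => f z.1 + h z.2) /\
    \int[g]_z (f z.1 + h z.2) = \int[m]_x f x + \int[n]_y h y.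
  move=> [c1 c2] fi hi.
  have f1 := integrableR_image measurable_fst c1 fi.
  have h1 := integrableR_image measurable_snd c2 hi.
  split; first exact: integrableRD.
  rewrite RintegralD// (Rintegral_image measurable_fst c1 fi).
  by rewrite (Rintegral_image measurable_snd c2 hi).
have [A1 A2] := int2 _ _ _ _ _ cg ip iq.
have [B1 B2] := int2 _ _ _ _ _ cg ip' iq'.
have [C1 C2] := int2 _ _ _ _ _ cg' jp jq.
have [D1 D2] := int2 _ _ _ _ _ cg' jp' jq'.
have E1 : \int[gamma]_z dot z.1 z.2 = \int[mu]_x phi x + \int[nu]_y psi y.
  rewrite -A2; apply: ae_eq_Rintegral.
  - exact: measurable_integrableR dg.
  - exact: measurable_integrableR A1.
  - by apply: filterS eg => z ->.
have E2 : \int[gamma']_z dot z.1 z.2 = \int[mu']_x phi' x + \int[nu']_y psi' y.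
  rewrite -D2; apply: ae_eq_Rintegral.
  - exact: measurable_integrableR dg'.
  - exact: measurable_integrableR D1.
  - by apply: filterS eg' => z ->.
have E3 : \int[gamma]_z dot z.1 z.2 <= \int[mu]_x phi' x + \int[nu]_y psi' y.
  rewrite -B2; apply: ae_le_Rintegral => //.
  by apply: filterS gr => z [z1 _]; exact: dual'.
rewrite RintegralB// C2 E2.
have := lipschitz_duality r10 r20' cs mur mur' phiL.
have := lipschitz_duality r10 r20' cs mur mur' phiL'.
have := lipschitz_duality r20 r10' ct nur nur' psiL.
have := lipschitz_duality r20 r10' ct nur nur' psiL'.
rewrite !ler_norml => /andP[a1 a2] /andP[b1 b2] /andP[c1 c2] /andP[d1 d2].
by rewrite E1 in E3; move: E3 a1 a2 b1 b2 c1 c2 d1 d2; clear; lra.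
Qed.

End estimates.

Section plan_estimate.
Context {R : realType} {d : nat}.
Implicit Types (mu nu : probability (Rd R d) R)
  (gamma : probability (Rd R d * Rd R d)%type R).

(** Convexity makes the integrand nonnegative, which is what lets a bound on the
    density of mu replace mu by the Lebesgue measure. *)
Lemma mean_second_difference mu (M r L e : R) (phi : Rd R d -> R) i :
  0 < r -> 0 <= L -> 0 < e -> 0 <= M ->
  {ae mu, forall x, cube r x} ->
  (forall A, measurable A -> (mu A <= M%:E * lebesgue_Rd R d A)%E) ->
  (forall x y, `|phi x - phi y| <= L * dist1 x y) ->
  (forall x, 2 * phi x <= phi (coord_shift i e x) + phi (coord_shift i (- e) x)) ->
  let D x := phi (coord_shift i e x) + phi (coord_shift i (- e) x) - 2 * phi x in
  integrableR mu D /\ \int[mu]_x D x <= M * (2 * L * (2 * r) ^+ d.-1 * e ^+ 2).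
Proof.
move=> r0 L0 e0 M0 mur muM phiL phic D.
have mphi : measurable_fun setT phi by exact: measurable_lipschitz L0 phiL.
have mphis a : measurable_fun setT (fun x => phi (coord_shift i a x)).
  exact: measurableT_comp mphi (measurable_shift i a).
have mD : measurable_fun setT D.
  by apply: measurable_funB; [exact: measurable_funD|exact: measurable_funM].
have D0 x : 0 <= D x by rewrite subr_ge0.
have DL x : D x <= 2 * (L * e).
  have := phiL (coord_shift i e x) x; have := phiL (coord_shift i (- e) x) x.
  rewrite !dist1_shift normrN (gtr0_norm e0) !ler_norml => /andP[_ +] /andP[_ +].
  by rewrite /D; lra.
have iD : integrableR mu D.
  apply: (integrableR_bounded (K := 2 * (L * e))) => //.
  by apply: aeW => x; rewrite ger0_norm.
split => //; rewrite -lee_fin EFin_Rintegral//.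
have mQ := @measurable_cube R d r.
have mED : measurable_fun setT (fun x => (D x)%:E) by exact/measurable_EFinP.
have -> : (\int[mu]_x (D x)%:E = \int[mu]_(x in cube r) (D x)%:E)%E.
  rewrite [RHS]integral_mkcond; apply: ae_eq_integral => //.
  - by apply/(measurable_restrictT _ mQ); exact: measurable_funTS mED.
  - by apply: filterS mur => x xr _; rewrite patchE mem_set.
have Mnn : 0 <= M by [].
have muM' A : measurable A -> (mu A <= mscale (NngNum Mnn) (lebesgue_Rd R d) A)%E by exact: muM.
apply: (le_trans (ge0_le_measure_integral muM' mQ _ mED)); first by move=> x; rewrite lee_fin.
rewrite (ge0_integral_mscale _ mQ _ (measurable_funTS mED)); last first.
  by move=> x _; rewrite lee_fin.
rewrite [leRHS]EFinM lee_wpmul2l//; exact: integral_second_difference.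
Qed.

(** The potentials are taken on a cube with one unit of margin, so that the dual
    inequality still holds at points moved by e along an axis. *)
Lemma plan_estimate mu nu mu' nu' gamma gamma' sigma tau (r1 r2 M s e : R) :
  0 < r1 -> 0 < r2 -> 0 < M -> 0 < s -> 0 < e -> e <= 1 ->
  {ae mu, forall x, cube r1 x} -> {ae nu, forall x, cube r2 x} ->
  {ae mu', forall x, cube r1 x} -> {ae nu', forall x, cube r2 x} ->
  (forall A, measurable A -> (mu A <= M%:E * lebesgue_Rd R d A)%E) ->
  optimal_coupling mu nu gamma -> optimal_coupling mu' nu' gamma' ->
  coupling mu mu' sigma -> coupling nu nu' tau ->
  \int[sigma]_z dist1 z.1 z.2 <= s -> \int[tau]_z dist1 z.1 z.2 <= s ->
  exists Pi : probability ((Rd R d * Rd R d) * (Rd R d * Rd R d))%type R,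
    [/\ coupling gamma gamma' Pi,
      \int[Pi]_z dist1 z.1.1 z.2.1 <= 2 * s &
      e * \int[Pi]_z dist1 z.1.2 z.2.2 <=
        d%:R * ((6 * r2 + 2 * (r1 + 1)) * s + M * (2 * r2 * (2 * r1) ^+ d.-1 * e ^+ 2))].
Proof.
move=> r10 r20 M0 s0 e0 e1 mur nur mur' nur' muM go go' cs ct sE tE.
have [cg _] := go; have [cg' _] := go'.
have r11 : 0 < r1 + 1 by rewrite addr_gt0.
have cubeW (m : probability (Rd R d) R) :
    {ae m, forall x, cube r1 x} -> {ae m, forall x, cube (r1 + 1) x}.
  by apply: filterS => x; apply: cubeS; rewrite lerDl.
have gr := coupling_cube cg mur nur; have gr' := coupling_cube cg' mur' nur'.
have grW := coupling_cube cg (cubeW _ mur) nur.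
have grW' := coupling_cube cg' (cubeW _ mur') nur'.
have [phi [psi [phiL psiL phic dual eg]]] := kantorovich_potentials r11 (ltW r20) go grW.
have [phi' [psi' [phiL' psiL' _ dual' eg']]] := kantorovich_potentials r11 (ltW r20) go' grW'.
have gap := duality_gap r11 r20 cg cg' cs ct (cubeW _ mur) nur (cubeW _ mur') nur'
  phiL phiL' psiL psiL' eg eg' dual'.
have s1 A : measurable A -> pushforward sigma fst A = gamma (fst @^-1` A).
  by move=> mA; rewrite cs.1// -cg.1.
have s2 A : measurable A -> pushforward sigma snd A = gamma' (fst @^-1` A).
  by move=> mA; rewrite cs.2// -cg'.1.
have fgr : {ae gamma, forall z, cube r1 z.1} by apply: filterS gr => z [].
have fgr' : {ae gamma', forall z, cube r1 z.1} by apply: filterS gr' => z [].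
have [Pi [cP PE]] := gluing_dist1 measurable_fst measurable_fst s1 s2 r10 s0 fgr fgr'
  (coupling_cube cs mur mur').
have PE2 : \int[Pi]_z dist1 z.1.1 z.2.1 <= 2 * s.
  by apply: le_trans PE _; rewrite mulr_natl mulr2n lerD2r.
exists Pi; split => //.
have Pg (A : Rd R d * Rd R d -> Prop) : {ae gamma, forall z, A z} -> {ae Pi, forall z, A z.1}.
  by move=> hA; exact: (ae_image measurable_fst cP.1 hA).
have Pg' (A : Rd R d * Rd R d -> Prop) : {ae gamma', forall z, A z} -> {ae Pi, forall z, A z.2}.
  by move=> hA; exact: (ae_image measurable_snd cP.2 hA).
pose D i x := phi (coord_shift i e x) + phi (coord_shift i (- e) x) - 2 * phi x.
pose gp (z : Rd R d * Rd R d) := phi z.1 + psi z.2 - dot z.1 z.2.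
(* Dual inequality at x + e e_i with y' and x - e e_i with y, or the other way
   round, according to the sign of the coordinate of y - y'. *)
have pw i : {ae Pi, forall z, e * `|tnth z.1.2 i - tnth z.2.2 i| <=
    D i z.1.1 + gp z.2 + 2 * r2 * dist1 z.1.1 z.2.1}.
  apply: filterS3 (Pg _ gr) (Pg' _ gr') (Pg _ eg).
  move=> [[x y] [x' y']] /= [xr yr] [xr' yr'] egxy.
  have cs1 a : `|a| = e -> cube (r1 + 1) (coord_shift i a x).
    by move=> ae; apply: cube_shift xr; rewrite ae addrC lerD2l.
  have c1 := cs1 e (gtr0_norm e0).
  have c2 : cube (r1 + 1) (coord_shift i (- e) x) by apply: cs1; rewrite normrN gtr0_norm.
  have F1 := dual _ y' c1; have F2 := dual _ y c2.
  have F3 := dual _ y c1; have F4 := dual _ y' c2.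
  rewrite !dot_shift in F1 F2 F3 F4.
  have := phiL x x'; rewrite ler_norml => /andP[_ G1].
  have := @dot_lipschitz _ _ r2 x x' y' (ltW r20) (fun j => ltW (yr' j)).
  rewrite ler_norml => /andP[G2 _].
  rewrite /D /gp /=; move: F1 F2 F3 F4 G1 G2 egxy; clear.
  by case: (ger0P (tnth y i - tnth y' i)) => _; lra.
have ip := integrableR_image measurable_fst cg'.1 (integrableR_lipschitz r10 (ltW r20) mur' phiL).
have iq := integrableR_image measurable_snd cg'.2 (integrableR_lipschitz r20 (ltW r11) nur' psiL).
have id := integrableR_dot (ltW r10) (ltW r20) measurable_fst measurable_snd gr'.
have gpi : integrableR gamma' gp := integrableRB (integrableRD ip iq) id.
have Ig := integrableR_image measurable_snd cP.2 gpi.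
have dr : {ae Pi, forall z, cube r1 z.1.1 /\ cube r1 z.2.1}.
  by apply: filterS2 (Pg _ fgr) (Pg' _ fgr') => z.
have dr2 : {ae Pi, forall z, cube r2 z.1.2 /\ cube r2 z.2.2}.
  by apply: filterS2 (Pg _ gr) (Pg' _ gr') => z [_ ?] [_ ?].
have Id := integrableR_dist1 measurable_fst_fst measurable_fst_snd dr.
have Ii i : integrableR Pi (fun z => `|tnth z.1.2 i - tnth z.2.2 i|).
  apply: integrable_norm; apply: integrableRB.
    by apply: (integrableR_coord i measurable_snd_fst (r := r2)); apply: filterS dr2 => z [].
  by apply: (integrableR_coord i measurable_snd_snd (r := r2)); apply: filterS dr2 => z [].
have bound i : e * \int[Pi]_z `|tnth z.1.2 i - tnth z.2.2 i| <=
    (6 * r2 + 2 * (r1 + 1)) * s + M * (2 * r2 * (2 * r1) ^+ d.-1 * e ^+ 2).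
  have [iD ED] := mean_second_difference r10 (ltW r20) e0 (ltW M0) mur muM phiL (phic i e).
  have iD1 := integrableR_image measurable_fst cg.1 iD.
  have iD2 := integrableR_image measurable_fst cP.1 iD1.
  rewrite -(RintegralZl e measurableT (Ii i)).
  apply: (@le_trans _ _ (\int[Pi]_z (D i z.1.1 + gp z.2 + 2 * r2 * dist1 z.1.1 z.2.1))).
    apply: ae_le_Rintegral (pw i); first exact: integrableRZ.
    by apply: integrableRD; [exact: integrableRD|exact: integrableRZ].
  rewrite (RintegralD _ (integrableRD iD2 Ig) (integrableRZ (2 * r2) Id))//.
  rewrite (RintegralD _ iD2 Ig)// (RintegralZl _ measurableT Id).
  rewrite (Rintegral_image measurable_fst cP.1 iD1) (Rintegral_image measurable_fst cg.1 iD).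
  rewrite (Rintegral_image measurable_snd cP.2 gpi).
  have h1 : 2 * r2 * \int[Pi]_z dist1 z.1.1 z.2.1 <= 2 * r2 * (2 * s).
    by rewrite ler_wpM2l ?mulr_ge0 ?(ltW r20).
  have h2 : 2 * r2 * \int[sigma]_z dist1 z.1 z.2 <= 2 * r2 * s.
    by rewrite ler_wpM2l ?mulr_ge0 ?(ltW r20).
  have h3 : 2 * (r1 + 1) * \int[tau]_z dist1 z.1 z.2 <= 2 * (r1 + 1) * s.
    by rewrite ler_wpM2l ?mulr_ge0 ?(ltW r11).
  have gapE : \int[gamma']_z gp z <= 2 * r2 * \int[sigma]_z dist1 z.1 z.2 +
    2 * (r1 + 1) * \int[tau]_z dist1 z.1 z.2 := gap.
  have EDE : \int[mu]_x D i x <= M * (2 * r2 * (2 * r1) ^+ d.-1 * e ^+ 2) := ED.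
  by move: gapE EDE h1 h2 h3; clear; lra.
have sumE := Rintegral_sum (index_enum 'I_d) Ii.
apply: (@le_trans _ _ (e * \sum_(i < d) \int[Pi]_z `|tnth z.1.2 i - tnth z.2.2 i|)).
  by rewrite -[X in _ <= _ * X]sumE.
rewrite mulr_sumr.
apply: le_trans (ler_sum _ (fun i _ => bound i)) _.
by rewrite sumr_const card_ord [leRHS]mulr_natl.
Qed.

End plan_estimate.

(** * Wasserstein distances *)

Section wasserstein.
Local Open Scope ereal_scope.
Context dT (T : measurableType dT) (R : realType) (dist : T -> T -> R).
Variables mu nu : probability T R.

Let cost2_ge0 :
  0 <= ereal_inf [set \int[gamma]_p (dist p.1 p.2 ^+ 2)%:E | gamma in coupling mu nu].
Proof.
apply: le_ereal_inf_tmp => _ [gamma _ <-]; apply: integral_ge0 => p _.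
by rewrite lee_fin sqr_ge0.
Qed.

Lemma wasserstein2_lt (s : R) : wasserstein2 dist mu nu < s%:E ->
  (0 < s)%R /\ exists2 gamma, coupling mu nu gamma &
    \int[gamma]_p (dist p.1 p.2 ^+ 2)%:E <= (s ^+ 2)%:E.
Proof.
move=> Ws; have s0 : (0 < s)%R by rewrite -lte_fin; apply: le_lt_trans Ws; exact: poweR_ge0.
split => //; move: Ws; rewrite /wasserstein2.
set I := ereal_inf _ => Ws; have I0 : 0 <= I by [].
have Is : I < (s ^+ 2)%:E.
  rewrite ltNge; apply/negP => sI; move: Ws; rewrite ltNge => /negP; apply.
  have -> : s%:E = (s ^+ 2)%:E `^ 2^-1.
    by rewrite poweR_EFin powR12_sqrt ?sqr_ge0// sqrtr_sqr gtr0_norm.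
  apply: gt0_ler_poweR => //; first by rewrite in_itv/= lee_fin sqr_ge0 leey.
  by rewrite in_itv/= I0 leey.
have [_ [gamma gc <-] /ltW gs] := ereal_inf_lt Is.
by exists gamma.
Qed.

Lemma wasserstein2_pow8_le (v : R) gamma : coupling mu nu gamma ->
  \int[gamma]_p (dist p.1 p.2 ^+ 2)%:E <= v%:E ->
  wasserstein2 dist mu nu ^+ 8 <= (v ^+ 4)%:E.
Proof.
move=> gc gv; rewrite /wasserstein2; set I := ereal_inf _.
have Iv : I <= v%:E by apply: le_trans gv; apply: ereal_inf_lbound; exists gamma.
have I0 : 0 <= I by exact: cost2_ge0.
have [r Ir] : exists r : R, I = r%:E.
  exists (fine I); rewrite fineK// ge0_fin_numE//; exact: le_lt_trans Iv (ltry _).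
rewrite Ir; rewrite Ir !lee_fin in I0 Iv; have r0 := I0; have rv := Iv.
have -> : r%:E `^ 2^-1 = (Num.sqrt r)%:E by rewrite poweR_EFin powR12_sqrt.
rewrite -EFin_expe lee_fin (_ : 8 = 2 * 4)%N//.
by rewrite exprM sqr_sqrtr// lerXn2r// nnegrE (le_trans r0).
Qed.

End wasserstein.

Section plan_stability.
Context {R : realType} {d : nat}.

Lemma euclid_dist_prod_sqr (p q : Rd R d * Rd R d) :
  euclid_dist_prod p q ^+ 2 = euclid_dist p.1 q.1 ^+ 2 + euclid_dist p.2 q.2 ^+ 2.
Proof. by rewrite sqr_sqrtr// addr_ge0// sqr_ge0. Qed.

Lemma integral_euclid_dist_prod_sqr
    (Pi : probability ((Rd R d * Rd R d) * (Rd R d * Rd R d))%type R) (r1 r2 : R) :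
  0 <= r1 -> 0 <= r2 ->
  {ae Pi, forall z, cube r1 z.1.1 /\ cube r1 z.2.1} ->
  {ae Pi, forall z, cube r2 z.1.2 /\ cube r2 z.2.2} ->
  (\int[Pi]_z (euclid_dist_prod z.1 z.2 ^+ 2)%:E <=
   (2 * r1 * \int[Pi]_z dist1 z.1.1 z.2.1 + 2 * r2 * \int[Pi]_z dist1 z.1.2 z.2.2)%:E)%E.
Proof.
move=> r10 r20 P1 P2.
have I1 := integrableR_dist1 measurable_fst_fst measurable_fst_snd P1.
have I2 := integrableR_dist1 measurable_snd_fst measurable_snd_snd P2.
have J1 := integrableRZ (2 * r1) I1; have J2 := integrableRZ (2 * r2) I2.
rewrite -(RintegralZl _ measurableT I1) -(RintegralZl _ measurableT I2).
rewrite -(RintegralD measurableT J1 J2) (EFin_Rintegral (integrableRD J1 J2)).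
apply: ae_ge0_le_integral => //.
- by move=> z _; rewrite lee_fin sqr_ge0.
- apply/measurable_EFinP; under eq_fun do rewrite euclid_dist_prod_sqr.
  apply: measurable_funD.
    exact: measurable_euclid_dist_sqr measurable_fst_fst measurable_fst_snd.
  exact: measurable_euclid_dist_sqr measurable_snd_fst measurable_snd_snd.
- move=> z _; rewrite lee_fin addr_ge0// mulr_ge0// ?mulr_ge0//; exact: dist1_ge0.
- by have /measurable_EFinP := measurable_integrableR (integrableRD J1 J2).
- apply: filterS2 P1 P2 => z [a b] [a' b'] _; rewrite lee_fin euclid_dist_prod_sqr.
  by apply: lerD; exact: euclid_dist_sqr_cube.
Qed.

Lemma Rintegral_dist1_le d' (T : measurableType d') (P : probability T R)
    (f g : T -> Rd R d) (r : R) :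
  measurable_fun setT f -> measurable_fun setT g ->
  {ae P, forall x, cube r (f x) /\ cube r (g x)} ->
  \int[P]_x dist1 (f x) (g x) <= d%:R * (2 * r).
Proof.
move=> mf mg fg; rewrite -[leRHS](Rintegral_prob_cst P).
apply: ae_le_Rintegral; [exact: integrableR_dist1 mf mg fg|exact: integrableR_cst|].
by apply: filterS fg => x [fx gx]; exact: cube_dist1.
Qed.

(** For s <= 1, the mean squared distance under the glued plan is at most this
    constant times the square root of s. *)
Definition near_const (r1 r2 M : R) : R := 4 * r1 * d%:R +
  2 * r2 * (d%:R * ((6 * r2 + 2 * (r1 + 1)) * d%:R + M * (2 * r2 * (2 * r1) ^+ d.-1))).

(** A bound on the mean squared distance under any plan that lives on the product
    of the cubes. *)
Definition far_const (r1 r2 : R) : R := 2 * r1 * (d%:R * (2 * r1)) + 2 * r2 * (d%:R * (2 * r2)).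

(** The step e = sqrt s balances the errors s / e and e.  It has to be at most 1,
    which is the margin of the potentials; but if s > 1 boundedness of the
    supports is enough. *)
Lemma plan_stability (mu nu mu' nu' : probability (Rd R d) R) gamma gamma' (r1 r2 M s : R) :
  (0 < d)%N -> 0 < r1 -> 0 < r2 -> 0 < M -> 0 < s ->
  {ae mu, forall x, cube r1 x} -> {ae nu, forall x, cube r2 x} ->
  {ae mu', forall x, cube r1 x} -> {ae nu', forall x, cube r2 x} ->
  (forall A, measurable A -> (mu A <= M%:E * lebesgue_Rd R d A)%E) ->
  optimal_coupling mu nu gamma -> optimal_coupling mu' nu' gamma' ->
  (exists2 sigma, coupling mu mu' sigma &
    (\int[sigma]_z (euclid_dist z.1 z.2 ^+ 2)%:E <= (s ^+ 2)%:E)%E) ->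
  (exists2 tau, coupling nu nu' tau &
    (\int[tau]_z (euclid_dist z.1 z.2 ^+ 2)%:E <= (s ^+ 2)%:E)%E) ->
  (wasserstein2 (@euclid_dist_prod R d) gamma gamma' ^+ 8 <=
    ((1 + near_const r1 r2 M + far_const r1 r2) ^+ 8 * s)%:E)%E.
Proof.
move=> d0 r10 r20 M0 s0 mur nur mur' nur' muM go go' [sigma cs sE] [tau ct tE].
have dR : 0 < d%:R :> R by rewrite ltr0n.
have [[cg _] [cg' _]] := (go, go').
have ds0 : 0 < d%:R * s by rewrite mulr_gt0.
have sE1 := mean_dist1 (ltW r10) s0 (coupling_cube cs mur mur') sE.
have tE1 := mean_dist1 (ltW r20) s0 (coupling_cube ct nur nur') tE.
pose e := Num.min 1 (Num.sqrt s).
have e0 : 0 < e by rewrite lt_min ltr01 sqrtr_gt0.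
have e1 : e <= 1 by rewrite ge_min lexx.
have [Pi [cP h1 h2]] := plan_estimate r10 r20 M0 ds0 e0 e1 mur nur mur' nur' muM
  go go' cs ct sE1 tE1.
have gr := coupling_cube cg mur nur; have gr' := coupling_cube cg' mur' nur'.
have [Pz Pz'] := (ae_image measurable_fst cP.1 gr, ae_image measurable_snd cP.2 gr').
have P1 : {ae Pi, forall z, cube r1 z.1.1 /\ cube r1 z.2.1}.
  by apply: filterS2 Pz Pz' => z [? _] [? _].
have P2 : {ae Pi, forall z, cube r2 z.1.2 /\ cube r2 z.2.2}.
  by apply: filterS2 Pz Pz' => z [_ ?] [_ ?].
have := integral_euclid_dist_prod_sqr (ltW r10) (ltW r20) P1 P2.
move: h1 h2; set I1 := \int[Pi]_z dist1 z.1.1 z.2.1; set I2 := \int[Pi]_z dist1 z.1.2 z.2.2.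
move=> h1 h2 hI.
have near0 : 0 <= near_const r1 r2 M.
  by rewrite /near_const !(addr_ge0, mulr_ge0, exprn_ge0, ltW r10, ltW r20, ltW M0).
have far0 : 0 <= far_const r1 r2.
  by rewrite /far_const !(addr_ge0, mulr_ge0, ltW r10, ltW r20).
set C := 1 + _ + _.
have C1 : 1 <= C by rewrite /C -addrA lerDl addr_ge0.
have fin (v : R) : 0 <= v -> v ^+ 4 <= C ^+ 4 * s -> ((v ^+ 4)%:E <= (C ^+ 8 * s)%:E)%E.
  move=> v0 vC; rewrite lee_fin (le_trans vC)// ler_pM2r// ler_weXn2l//.
have [s1|s1] := leP s 1.
  have sq1 : Num.sqrt s <= 1 by rewrite -(sqrtr1 R) ler_wsqrtr.
  have eE : e = Num.sqrt s by rewrite /e min_r.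
  have e2 : e ^+ 2 = s by rewrite eE sqr_sqrtr// ltW.
  have se : s <= e by rewrite -e2 expr2 ler_piMl// ltW.
  have I1e : I1 <= 2 * (d%:R * e).
    by apply: (le_trans h1); rewrite ler_pM2l// ler_pM2l.
  have I2e : I2 <= d%:R * ((6 * r2 + 2 * (r1 + 1)) * d%:R + M * (2 * r2 * (2 * r1) ^+ d.-1)) * e.
    rewrite -(ler_pM2l e0); apply: (le_trans h2).
    rewrite le_eqVlt; apply/orP; left; apply/eqP; rewrite -e2; ring.
  have v : 2 * r1 * I1 + 2 * r2 * I2 <= near_const r1 r2 M * e.
    rewrite /near_const [leRHS]mulrDl; apply: lerD.
      apply: (@le_trans _ _ (2 * r1 * (2 * (d%:R * e)))); first by rewrite ler_pM2l// mulr_gt0.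
      by rewrite le_eqVlt; apply/orP; left; apply/eqP; ring.
    by rewrite -[leRHS]mulrA ler_pM2l// mulr_gt0.
  have hv : (\int[Pi]_z (euclid_dist_prod z.1 z.2 ^+ 2)%:E <= (near_const r1 r2 M * e)%:E)%E.
    by apply: (le_trans hI); rewrite lee_fin.
  apply: (le_trans (wasserstein2_pow8_le cP hv)); apply: fin; first by rewrite mulr_ge0// ltW.
  rewrite exprMn; apply: ler_pM; rewrite ?exprn_ge0 ?(ltW e0)//.
    rewrite lerXn2r ?nnegrE//; first exact: le_trans C1.
    by rewrite /C addrAC lerDr addr_ge0.
  by rewrite (_ : 4 = 2 * 2)%N// exprM e2 expr2 ler_piMl// ltW.
have I1e : I1 <= d%:R * (2 * r1).
  exact: Rintegral_dist1_le measurable_fst_fst measurable_fst_snd P1.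
have I2e : I2 <= d%:R * (2 * r2).
  exact: Rintegral_dist1_le measurable_snd_fst measurable_snd_snd P2.
have hv : (\int[Pi]_z (euclid_dist_prod z.1 z.2 ^+ 2)%:E <= (far_const r1 r2)%:E)%E.
  by apply: (le_trans hI); rewrite lee_fin lerD// ler_pM2l// mulr_gt0.
apply: (le_trans (wasserstein2_pow8_le cP hv)); apply: fin => //.
apply: (@le_trans _ _ (C ^+ 4)); last by rewrite ler_peMr ?exprn_ge0 ?(le_trans ler01)// ltW.
rewrite lerXn2r ?nnegrE//; first exact: le_trans C1.
by rewrite /C lerDr addr_ge0.
Qed.

End plan_stability.

Theorem corollary5p4 (R : realType) (d : nat) (d_gt0 : (0 < d)%N)
    (Rmu Rnu M : R) (Rmu_gt0 : 0 < Rmu) (Rnu_gt0 : 0 < Rnu) (M_gt0 : 0 < M) :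
  exists2 C : R, 0 < C &
    forall (mu nu mu' nu' : probability (Rd R d) R)
           (gamma gamma' : probability (Rd R d * Rd R d)%type R),
      supported_on mu (@euclid_ball R d Rmu) ->
      supported_on nu (@euclid_ball R d Rnu) ->
      (forall A : set (Rd R d),
         measurable A -> (mu A <= M%:E * lebesgue_Rd R d A)%E) ->
      optimal_coupling mu nu gamma ->
      supported_on mu' (@euclid_ball R d Rmu) ->
      supported_on nu' (@euclid_ball R d Rnu) ->
      optimal_coupling mu' nu' gamma' ->
      ((1 / C ^+ 8)%:E * wasserstein2 (@euclid_dist_prod R d) gamma gamma' ^+ 8 <=
       wasserstein2 (@euclid_dist R d) mu mu' + wasserstein2 (@euclid_dist R d) nu nu')%E.
Proof.
pose C : R := 1 + near_const (d := d) Rmu Rnu M + far_const (d := d) Rmu Rnu.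
have C0 : 0 < C.
  rewrite /C -addrA ltr_pwDl// addr_ge0// /near_const /far_const.
    by rewrite !(addr_ge0, mulr_ge0, exprn_ge0, ltW Rmu_gt0, ltW Rnu_gt0, ltW M_gt0).
  by rewrite !(addr_ge0, mulr_ge0, ltW Rmu_gt0, ltW Rnu_gt0).
exists C => // mu nu mu' nu' gamma gamma' /supported_on_cube mur /supported_on_cube nur muM go
  /supported_on_cube mur' /supported_on_cube nur' go'.
have W1 : (0 <= wasserstein2 (@euclid_dist R d) mu mu')%E by exact: poweR_ge0.
have W2 : (0 <= wasserstein2 (@euclid_dist R d) nu nu')%E by exact: poweR_ge0.
case E1 : (wasserstein2 (@euclid_dist R d) mu mu') W1 => [w1| |]// w10; last first.
  by rewrite addye ?leey//; case: wasserstein2 W2.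
case E2 : (wasserstein2 (@euclid_dist R d) nu nu') W2 => [w2| |]// w20; last first.
  by rewrite addey ?leey.
rewrite !lee_fin in w10 w20.
apply/lee_addgt0Pr => eps eps0; rewrite -!EFinD.
set s := w1 + w2 + eps.
have s0 : 0 < s by rewrite ltr_wpDl// addr_ge0.
have := wasserstein2_lt (dist := @euclid_dist R d) (mu := mu) (nu := mu') (s := s).
have := wasserstein2_lt (dist := @euclid_dist R d) (mu := nu) (nu := nu') (s := s).
rewrite E1 E2 !lte_fin => /(_ _)[|_ ct]; first by rewrite /s; lra.
move=> /(_ _)[|_ cs]; first by rewrite /s; lra.
have main := plan_stability d_gt0 Rmu_gt0 Rnu_gt0 M_gt0 s0 mur nur mur' nur' muM go go' cs ct.
have CC : 0 <= 1 / C ^+ 8 by rewrite divr_ge0// exprn_ge0// ltW.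
apply: (@le_trans _ _ ((1 / C ^+ 8)%:E * (C ^+ 8 * s)%:E)%E).
  by apply: lee_wpmul2l; rewrite ?lee_fin.
by rewrite -EFinM lee_fin mulrA divfK ?mul1r// gt_eqF// exprn_gt0.
Qed.
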